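(* Let $n\ge1$ and let $T$ and $T'$ be triangulations of the convex $(n+2)$-gon $\mathsf{P}_{n+2}$. Then the fans $\Sigma_T$ and $\Sigma_{T'}$ are isomorphic (equivalently, the toric varieties $X(\Sigma_T)$ and $X(\Sigma_{T'})$ are isomorphic) if and only if the binary trees $\mathcal{B}_T$ and $\mathcal{B}_{T'}$ are isomorphic as unordered rooted trees.
   Context: Triangulations. Let $\mathsf{P}_{n+2}$ be a convex $(n+2)$-gon with vertices labelled $0,1,\dots,n+1$ in counterclockwise order. A triangulation $T$ of $\mathsf{P}_{n+2}$ is a decomposition into $n$ triangles by $n-1$ diagonals not crossing in their interiors; $T$ is also regarded as the set of all edges of these triangles (sides and chosen diagonals). Put $e=\{0,n+1\}$, the distinguished edge. Left and right trees. Define $F\colon T\setminus\{e\}\to\{\mathsf{L},\mathsf{R}\}$ recursively: for a triangulated polygon with distinguished edge $g$ (starting with $\mathsf{P}_{n+2}$ and $g=e$), the unique triangle containing $g$ has two other edges $f_{\mathsf{L}}(g),f_{\mathsf{R}}(g)$, named so that $f_{\mathsf{L}}(g),f_{\mathsf{R}}(g),g$ are placed counterclockwise; set $F(f_{\mathsf{L}}(g))=\mathsf{L}$, $F(f_{\mathsf{R}}(g))=\mathsf{R}$. Removing $g$ leaves two triangulated polygons (possibly single edges) with one common vertex and with distinguished edges $f_{\mathsf{L}}(g)$ and $f_{\mathsf{R}}(g)$; repeat for each of them that is not a single edge. The left tree $\mathcal{T}_T^{\mathsf{L}}$ has vertex set $\{0,\dots,n\}$, root $0$ and edge set $F^{-1}(\mathsf{L})$;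 the right tree $\mathcal{T}_T^{\mathsf{R}}$ has vertex set $\{1,\dots,n+1\}$, root $n+1$ and edge set $F^{-1}(\mathsf{R})$. For each $1\le k\le n$ there is exactly one edge $\{k_{\mathsf{L}},k\}$ of $\mathcal{T}_T^{\mathsf{L}}$ with $k_{\mathsf{L}}<k$ and exactly one edge $\{k,k_{\mathsf{R}}\}$ of $\mathcal{T}_T^{\mathsf{R}}$ with $k<k_{\mathsf{R}}$; this defines $k_{\mathsf{L}},k_{\mathsf{R}}$. Vectors and fan. Let $N=\mathbb{Z}^{n+1}/\mathbb{Z}(1,\dots,1)$ and let $\varpi_i\in N$ be the image of $\sum_{k=1}^i e_k$ ($0\le i\le n+1$), so $\varpi_0=\varpi_{n+1}=0$. Put $\mathbf{v}_k=\varpi_k-\varpi_{k_{\mathsf{R}}}$ and $\mathbf{w}_k=\varpi_{k_{\mathsf{L}}}-\varpi_k$ for $k\in[n]=\{1,\dots,n\}$. $\Sigma_T$ is the complete non-singular fan in $N\otimes\mathbb{R}$ consisting of the cones $\operatorname{Cone}(Q)$ for subsets $Q\subset\{\mathbf{v}_k,\mathbf{w}_k\mid k\in[n]\}$ with $\{\mathbf{v}_i,\mathbf{w}_i\}\not\subset Q$ for all $i\in[n]$. $X(\Sigma_T)$ is the corresponding toric variety over $\mathbb{C}$. Two fans are isomorphic if there is an isomorphism of the underlying lattices that induces a bijection between their cones. Binary trees. A binary tree is either empty or has a root vertex, a left subtree and a right subtree, both binary trees. $\mathcal{B}_T$ is the binary tree with $n$ vertices whose vertices are the triangles of $T$, whose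 root is the triangle containing $e$, and in which the left (right) child of a triangle with distinguished edge $g$ is the other triangle containing $f_{\mathsf{L}}(g)$ (respectively $f_{\mathsf{R}}(g)$), if any. Two binary trees are isomorphic as unordered rooted trees if there is a bijection between their vertex sets sending root to root and inducing a bijection of edges (not necessarily preserving left and right children). *)

(* Defs.v *)
From HB Require Import structures.
From mathcomp Require Import all_boot all_order all_algebra.
From mathcomp Require Import complex lra.
From mathcomp Require Import boolp classical_sets functions reals.
Set Implicit Arguments.
Unset Strict Implicit.
Unset Printing Implicit Defensive.
Import Order.TTheory GRing.Theory Num.Theory.
Local Open Scope ring_scope.

(* Triangulations of the convex (n+2)-gon with vertices 0, ..., n+1.
   A pair (a, b) with a < b stands for the edge {a, b}. *)

Section Triangulation.
Variable n : nat.

Definition vtx := 'I_n.+2.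
Definition edge := (vtx * vtx)%type.

Definition root_edge : edge := (ord0, ord_max).

Definition is_side (f : edge) : bool :=
  (f == root_edge) || (f.2 == f.1.+1 :> nat).

Definition crossing (f g : edge) : bool := (f.1 < g.1 < f.2)%N && (f.2 < g.2)%N.

Definition is_triangulation (T : {set edge}) : Prop :=
  [/\ forall f, f \in T -> (f.1 < f.2)%N,
      forall f : edge, is_side f -> f \in T,
      forall f g, f \in T -> g \in T -> ~~ crossing f g
    & #|[set f in T | ~~ is_side f]| = n.-1].

Variable T : {set edge}.

(* The sub-polygon with distinguished edge (a, b) has the vertices a, ..., b
   in counterclockwise order, so the third vertex k of its triangle on (a, b)
   satisfies a < k < b, and {a, k}, {k, b}, {a, b} is counterclockwise. *)
Definition apex (g : edge) (k : vtx) : bool :=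
  [&& (g.1 < k < g.2)%N, g \in T, (g.1, k) \in T & (k, g.2) \in T].

Definition fL (t : edge * vtx) : edge := (t.1.1, t.2).
Definition fR (t : edge * vtx) : edge := (t.2, t.1.2).

Definition dist_step (g f : edge) : bool :=
  [exists k, apex g k && ((f == fL (g, k)) || (f == fR (g, k)))].

Definition distinguished (g : edge) : bool := connect dist_step root_edge g.

(* The triangles of T; (g, k) is the triangle with distinguished edge g and
   third vertex k. *)
Definition triangles : {set edge * vtx} :=
  [set t | distinguished t.1 && apex t.1 t.2].

(* The edges labelled L, resp. R: the edges of the left and right trees *)
Definition Ledges : {set edge} := [set fL t | t in triangles].
Definition Redges : {set edge} := [set fR t | t in triangles].

(* The default value k is never used for 1 <= k <= n. *)
Definition kL (k : vtx) : vtx := odflt k [pick x : vtx | (x < k)%N && ((x, k) \in Ledges)].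
Definition kR (k : vtx) : vtx := odflt k [pick x : vtx | (k < x)%N && ((k, x) \in Redges)].

End Triangulation.

(* Binary trees on a set of vertices taken from V *)
Record bintree (V : finType) := BinTree {
  bt_vertices : {set V};
  bt_root : pred V;
  bt_left : rel V;    (* bt_left x y : y is the left child of x *)
  bt_right : rel V }.

Definition bt_child (V : finType) (B : bintree V) : rel V :=
  fun x y => bt_left B x y || bt_right B x y.

Definition bt_edge (V : finType) (B : bintree V) : rel V :=
  fun x y => bt_child B x y || bt_child B y x.

Definition unordered_iso (V V' : finType) (B : bintree V) (B' : bintree V') : Prop :=
  exists f : V -> V',
    [/\ {in bt_vertices B &, injective f},
        f @: bt_vertices B = bt_vertices B',
        {in bt_vertices B, forall x, bt_root B' (f x) = bt_root B x}
      & {in bt_vertices B &, forall x y, bt_edge B' (f x) (f y) = bt_edge B x y}].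

Section BinaryTreeOfTriangulation.
Variables (n : nat) (T : {set edge n}).

Definition has_edge (t : edge n * vtx n) (f : edge n) : bool :=
  f \in [:: t.1; fL t; fR t].

Definition binary_tree : bintree (edge n * vtx n)%type :=
  @BinTree _ (triangles T)
    (fun t => (t \in triangles T) && has_edge t (root_edge n))
    (fun t t' => [&& t \in triangles T, t' \in triangles T, t' != t & has_edge t' (fL t)])
    (fun t t' => [&& t \in triangles T, t' \in triangles T, t' != t & has_edge t' (fR t)]).

End BinaryTreeOfTriangulation.

(* The lattice N = Z^(n+1) / Z(1, ..., 1) is realised as Z^n through the
   quotient map latN below, which is additive, onto, and identifies exactly
   the vectors that differ by a multiple of (1, ..., 1). *)

Definition latN n (x : 'rV[int]_n.+1) : 'rV[int]_n :=
  \row_(i < n) (x 0 (widen_ord (leqnSn n) i) - x 0 (lift ord0 i)).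

Lemma latND n (x y : 'rV[int]_n.+1) : latN (x + y) = latN x + latN y.
Proof. by apply/rowP => i; rewrite !mxE opprD addrACA. Qed.

Lemma latN_eq n (x y : 'rV[int]_n.+1) :
  latN x = latN y <-> exists c : int, x - y = const_mx c.
Proof.
split=> [/rowP exy|[c /rowP exy]].
  exists (x 0 0 - y 0 0); apply/rowP => -[i hi]; rewrite !mxE.
  elim: i hi => [|i IHi] hi; first by congr (x _ _ - y _ _); apply: val_inj.
  rewrite -(IHi (ltnW hi)).
  have := exy (Ordinal (hi : (i < n)%N)); rewrite !mxE.
  have -> : lift ord0 (Ordinal (hi : (i < n)%N)) = Ordinal hi by apply: val_inj.
  have -> : widen_ord (leqnSn n) (Ordinal (hi : (i < n)%N)) = Ordinal (ltnW hi)
    by apply: val_inj.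
  by move=> e; lra.
apply/rowP => i; rewrite !mxE.
have := exy (lift ord0 i); have := exy (widen_ord (leqnSn n) i); rewrite !mxE.
by move=> e1 e2; lra.
Qed.

Lemma latN_onto n (z : 'rV[int]_n) : exists x, latN x = z.
Proof.
exists (\row_(i < n.+1) \sum_(j < n | (i <= j)%N) z 0 j).
apply/rowP => i; rewrite !mxE /= (bigD1 i) //=.
rewrite (eq_bigl (fun j : 'I_n => (lift ord0 i <= j)%N)) ?addrK // => j.
by rewrite /= /bump leq0n add1n andbC -val_eqE /= ltn_neqAle eq_sym.
Qed.

(* the image of e_1 + ... + e_i in N; the basis of Z^(n+1) is indexed from 0 *)
Definition varpi n (i : vtx n) : 'rV[int]_n :=
  latN (\sum_(k < n.+1 | (k < i)%N) delta_mx 0 k).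

Definition vvec n (T : {set edge n}) (k : vtx n) : 'rV[int]_n :=
  varpi k - varpi (kR T k).

Definition wvec n (T : {set edge n}) (k : vtx n) : 'rV[int]_n :=
  varpi (kL T k) - varpi k.

(* k lies in [n] = {1, ..., n} *)
Definition inner n (k : vtx n) : bool := (0 < k < n.+1)%N.

(* Cones and fans, in the lattice Z^d inside R^d *)

Section Fans.
Variables (R : realType) (d : nat).

Definition cone (Q : seq 'rV[int]_d) : set 'rV[R]_d :=
  [set x | exists c : 'rV[int]_d -> R,
     (forall q, 0 <= c q) /\ x = \sum_(q <- Q) c q *: map_mx intr q].

(* The lattice isomorphisms of Z^d are the x |-> x *m A for A in GL_d(Z). *)
Definition fan_iso (Sg Sg' : set (set 'rV[R]_d)) : Prop :=
  exists2 A : 'M[int]_d, A \in unitmx &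
    set_bij Sg Sg' (fun s => [set x *m map_mx intr A | x in s]%classic).

End Fans.

Definition triangulation_fan (R : realType) n (T : {set edge n}) : set (set 'rV[R]_n) :=
  [set s | exists Q : seq 'rV[int]_n,
     [/\ forall q, q \in Q ->
           exists2 k : vtx n, inner k & q = vvec T k \/ q = wvec T k,
         forall k : vtx n, inner k -> ~ (vvec T k \in Q /\ wvec T k \in Q)
       & s = cone Q]].

Arguments triangulation_fan R {n} T.

(* The complex toric variety of a fan Sg in Z^d, as a space of closed points.
   For s in Sg, the affine chart U_s = Spec C[S_s], S_s the dual monoid of s,
   has as closed points the monoid morphisms from S_s to C with multiplication,
   and U_s and U_s' are glued along their common open subset U_(s `&` s').  The variety is the
   type chart_point of points of charts modulo same_point. *)

Section ToricVariety.
Variable R : realType.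

Definition pairing d (m : 'rV[int]_d) (u : 'rV[R]_d) : R :=
  \sum_(i < d) (m 0 i)%:~R * u 0 i.

Definition dual_monoid d (s : set 'rV[R]_d) : set 'rV[int]_d :=
  [set m | forall u, s u -> 0 <= pairing m u].

Definition monoid_hom d (S : set 'rV[int]_d) (gamma : 'rV[int]_d -> R[i]) : Prop :=
  gamma 0 = 1 /\
  forall m m', S m -> S m' -> gamma (m + m') = gamma m * gamma m'.

(* Only the values of pt_val on the dual monoid of the chart are meaningful. *)
Record chart_point d (Sg : set (set 'rV[R]_d)) := ChartPoint {
  chart : set 'rV[R]_d;
  pt_val : 'rV[int]_d -> R[i];
  chart_in : Sg chart;
  val_hom : monoid_hom (dual_monoid chart) pt_val }.

Definition same_point d (Sg : set (set 'rV[R]_d)) (x y : chart_point Sg) : Prop :=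
  exists delta : 'rV[int]_d -> R[i],
    [/\ monoid_hom (dual_monoid (chart x `&` chart y)%classic) delta,
        forall m, dual_monoid (chart x) m -> delta m = pt_val x m
      & forall m, dual_monoid (chart y) m -> delta m = pt_val y m].

(* Regular functions on U_s: combinations of the characters in S_s *)
Definition in_coordinate_ring d (s : set 'rV[R]_d) (p : seq (R[i] * 'rV[int]_d)) : Prop :=
  forall t, t \in p -> dual_monoid s t.2.

Definition ev d (Sg : set (set 'rV[R]_d)) (p : seq (R[i] * 'rV[int]_d))
    (x : chart_point Sg) : R[i] :=
  \sum_(t <- p) t.1 * pt_val x t.2.

(* f is a morphism of varieties: every x has a principal open neighbourhood
   D(g) in its chart that f maps into the chart U of f x, and the pullback of
   each character regular on U is of the form a / g ^+ e on D(g). *)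
Definition morphism d d' (Sg : set (set 'rV[R]_d)) (Sg' : set (set 'rV[R]_d'))
    (f : chart_point Sg -> chart_point Sg') : Prop :=
  (forall x y, same_point x y -> same_point (f x) (f y)) /\
  (forall x, exists g,
     [/\ in_coordinate_ring (chart x) g, ev g x != 0
       & forall m, dual_monoid (chart (f x)) m ->
         exists a, exists2 e : nat, in_coordinate_ring (chart x) a &
           forall y : chart_point Sg, chart y = chart x -> ev g y != 0 ->
           exists z, [/\ same_point z (f y), chart z = chart (f x)
                       & pt_val z m = ev a y / ev g y ^+ e]]).

(* The torus is the chart of the zero cone. *)
Definition in_torus d (Sg : set (set 'rV[R]_d)) (x : chart_point Sg) : Prop :=
  exists2 y : chart_point Sg, same_point y x & chart y = [set 0]%classic.

Definition torus_mul d (Sg : set (set 'rV[R]_d)) (x y z : chart_point Sg) : Prop :=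
  exists x' y' z' : chart_point Sg,
    [/\ [/\ same_point x' x, same_point y' y & same_point z' z],
        [/\ chart x' = [set 0]%classic, chart y' = [set 0]%classic
          & chart z' = [set 0]%classic]
      & forall m, pt_val z' m = pt_val x' m * pt_val y' m].

Definition toric_morphism d d' (Sg : set (set 'rV[R]_d)) (Sg' : set (set 'rV[R]_d'))
    (f : chart_point Sg -> chart_point Sg') : Prop :=
  [/\ morphism f,
      forall x, in_torus x -> in_torus (f x)
    & forall x y z, torus_mul x y z -> torus_mul (f x) (f y) (f z)].

Definition toric_iso d d' (Sg : set (set 'rV[R]_d)) (Sg' : set (set 'rV[R]_d')) : Prop :=
  exists (f : chart_point Sg -> chart_point Sg') (g : chart_point Sg' -> chart_point Sg),
    [/\ toric_morphism f, toric_morphism g,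
        forall x, same_point (g (f x)) x & forall y, same_point (f (g y)) y].

End ToricVariety.

(* Main.v *)
(** Each edge [f = {a, b}] of T other than [e] gives the generator
    [x_f = varpi a - varpi b], and the two lower edges of a triangle are the pairs
    [v_k, w_k], whose sum is [x_g] for the upper edge [g] of that triangle ([0] when [g = e]).
    A lattice isomorphism that permutes the generators and respects these pairs therefore
    sees exactly which triangle hangs below which edge, up to exchanging the two lower
    edges of a triangle; conversely an isomorphism of unordered trees prescribes, from the root
    downwards, a compatible permutation of the generators.  The same triangle relations make it
    possible to choose the values of an integer functional on one edge of each pair freely,
    from the root downwards; this yields functionals separating any two cones of the fan.

    An isomorphism of fans preserves generators because they are primitive, and pairs because
    they are the pairs of generators that do not span a cone.  A toric isomorphism induces an
    integer matrix since a multiplicative rational function on the punctured line is a power;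
    regularity at the distinguished point of a maximal cone shows that this matrix maps the
    cone into a cone of the other fan, and comparing with the inverse shows that it permutes
    the generators. *)

Require Import Defs.
From mathcomp Require Import all_boot all_order all_algebra reals.
From mathcomp Require Import zify ring lra boolp.
Set Implicit Arguments.
Unset Strict Implicit.
Unset Printing Implicit Defensive.
Import Order.TTheory GRing.Theory Num.Theory.
Local Open Scope ring_scope.

(** * Triangles of a triangulation *)

Lemma card_inner n : #|[set k : vtx n | inner k]| = n.
Proof.
have -> : [set k : vtx n | inner k] = ~: [set ord0; ord_max].
  by apply/setP => k; rewrite !inE /inner -!val_eqE /=; have := ltn_ord k; lia.
by rewrite cardsCs setCK cards2 card_ord /=; lia.
Qed.

Section TriangulationFacts.
Local Open Scope nat_scope.
Variables (n : nat) (T : {set edge n}).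
Hypotheses (n_gt0 : 0 < n) (hT : is_triangulation T).

(* The implicit type arguments of [fst] and [snd] come in several convertible
   forms, which [lia] would treat as different atoms. *)
Ltac elia :=
  repeat match goal with
  | H : context [@fst ?A ?B ?f] |- _ =>
    lazymatch A with vtx _ => fail | _ => change (@fst A B f) with (@fst (vtx n) (vtx n) f) in H end
  | H : context [@snd ?A ?B ?f] |- _ =>
    lazymatch A with vtx _ => fail | _ => change (@snd A B f) with (@snd (vtx n) (vtx n) f) in H end
  | |- context [@fst ?A ?B ?f] =>
    lazymatch A with vtx _ => fail | _ => change (@fst A B f) with (@fst (vtx n) (vtx n) f) end
  | |- context [@snd ?A ?B ?f] =>
    lazymatch A with vtx _ => fail | _ => change (@snd A B f) with (@snd (vtx n) (vtx n) f) end
  end; lia.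

Lemma tri_lt f : f \in T -> f.1 < f.2.
Proof. by case: hT => h _ _ _; apply: h. Qed.

Lemma tri_side (f : edge n) : is_side f -> f \in T.
Proof. by case: hT => _ h _ _; apply: h. Qed.

Lemma tri_noncrossing f g : f \in T -> g \in T ->
  [|| g.1 <= f.1, f.2 <= g.1 | g.2 <= f.2].
Proof.
by case: hT => _ _ h _ fT gT; have := h f g fT gT; rewrite /crossing; elia.
Qed.

Lemma root_edge_in : root_edge n \in T.
Proof. by apply: tri_side; rewrite /is_side eqxx. Qed.

(** These are the edges with a triangle below them: the diagonals and the root edge. *)
Definition long_edges : {set edge n} := [set f in T | f.1.+1 < f.2].

Lemma card_long_edges : #|long_edges| = n.
Proof.
case: (hT) => _ _ _ hc.
have -> : long_edges = root_edge n |: [set f in T | ~~ is_side f].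
  apply/setP => f; rewrite !inE /is_side.
  have [->|ne] /= := eqVneq f (root_edge n); first by rewrite root_edge_in /=; elia.
  case fT: (f \in T) => //=; have h := tri_lt fT.
  by rewrite ltn_neqAle eq_sym h andbT.
rewrite cardsU1 !inE /is_side eqxx andbF /= hc; elia.
Qed.

(** The shortest edge passing over [k] will turn out to be the upper edge of the triangle with apex
    [k]. The root edge passes over every inner vertex, so the minimum is taken over a nonempty set
    when [k] is inner. *)
Definition least_over (k : vtx n) : edge n :=
  [arg min_(f < root_edge n | (f \in T) && (f.1 < k < f.2)) (f.2 - f.1)].

(** Two noncrossing edges that both pass over [k] are nested, so the shortest one lies inside all
    the others. *)
Lemma least_overP k : inner k ->
  [/\ least_over k \in T, (least_over k).1 < k < (least_over k).2
    & forall g, g \in T -> g.1 < k < g.2 ->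
        (g.1 <= (least_over k).1) && ((least_over k).2 <= g.2)].
Proof.
move=> ik; rewrite /least_over; case: arg_minnP; first by rewrite root_edge_in.
move=> f /andP[fT fk] fmin; split=> // g gT gk.
have := fmin g; rewrite gT gk => /(_ isT) le.
have := @tri_noncrossing f g fT gT; have := @tri_noncrossing g f gT fT.
move=> h1 h2; apply/andP; split; apply: contraT => hn; exfalso; elia.
Qed.

Lemma least_over_eq k g : inner k -> g \in T -> g.1 < k < g.2 ->
  (forall f, f \in T -> f.1 < k < f.2 -> (f.1 <= g.1) && (g.2 <= f.2)) ->
  least_over k = g.
Proof.
move=> ik gT gk gmin; have [lT lk lmin] := least_overP ik.
have := gmin _ lT lk; have := lmin _ gT gk.
case: (least_over k) g {gT gk gmin lT lk lmin} => [a b] [c d] /= h1 h2.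
by congr pair; apply: val_inj; rewrite /=; elia.
Qed.

Lemma side_in (a b : vtx n) : b = a.+1 :> nat -> (a, b) \in T.
Proof. by move=> e; apply: tri_side; rewrite /is_side /= e eqxx orbT. Qed.

(** Take the last neighbour [k] of [g.1] before [g.2]. An edge over [k] cannot cross [(g.1, k)], so
    it starts at or before [g.1]; if it ended before [g.2] it would have to start at [g.1], giving a
    later neighbour. *)
Lemma long_edge_left g : g \in long_edges ->
  exists2 k, inner k && (least_over k == g) & (g.1, k) \in T.
Proof.
rewrite inE => /andP[gT gl].
have hb : g.1.+1 < n.+2 by have := ltn_ord g.2; elia.
pose a1 : vtx n := Ordinal hb.
pose P k := ((g.1, k) \in T) && (k < g.2).
have P1 : P a1 by rewrite /P side_in.
case: (@arg_maxnP _ a1 P (fun k => k : nat) P1) => k /andP[kT klt] kmax.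
have gk := tri_lt kT; rewrite /= in gk.
have ik : inner k by rewrite /inner; have := ltn_ord g.2; elia.
exists k => //; rewrite ik /=; apply/eqP/least_over_eq => // [|f fT fk]; first elia.
have := @tri_noncrossing (g.1, k) f kT fT; rewrite /=.
have := @tri_noncrossing g f gT fT; have := @tri_noncrossing f g fT gT.
move=> h1 h2 h3; apply/andP; split; first by apply: contraT => ?; exfalso; elia.
apply: contraT => fg; exfalso.
have ef : f.1 = g.1.
  by apply: val_inj => /=; apply/eqP; apply: contraT => ?; exfalso; elia.
have : P f.2 by rewrite /P -ef -surjective_pairing fT; elia.
by move/kmax; elia.
Qed.

Lemma long_edge_right g : g \in long_edges ->
  exists2 k, inner k && (least_over k == g) & (k, g.2) \in T.
Proof.
rewrite inE => /andP[gT gl].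
have hb : g.2.-1 < n.+2 by have := ltn_ord g.2; elia.
pose a1 : vtx n := Ordinal hb.
pose P k := ((k, g.2) \in T) && (g.1 < k).
have P1 : P a1 by rewrite /P side_in /=; elia.
case: (@arg_minnP _ a1 P (fun k => k : nat) P1) => k /andP[kT klt] kmin.
have gk := tri_lt kT; rewrite /= in gk.
have ik : inner k by rewrite /inner; have := ltn_ord g.2; elia.
exists k => //; rewrite ik /=; apply/eqP/least_over_eq => // [|f fT fk]; first elia.
have := @tri_noncrossing f (k, g.2) fT kT; rewrite /=.
have := @tri_noncrossing g f gT fT; have := @tri_noncrossing f g fT gT.
move=> h1 h2 h3; apply/andP; split; last by apply: contraT => ?; exfalso; elia.
apply: contraT => fg; exfalso.
have ef : f.2 = g.2.
  by apply: val_inj => /=; apply/eqP; apply: contraT => ?; exfalso; elia.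
have : P f.1 by rewrite /P -ef -surjective_pairing fT; elia.
by move/kmin; elia.
Qed.

(* [least_over] maps the n inner vertices onto the n long edges, so it is injective. *)
Lemma least_over_inj : {in [set k : vtx n | inner k] &, injective least_over}.
Proof.
apply/imset_injP; rewrite eqn_leq leq_imset_card card_inner.
rewrite -[X in X <= _]card_long_edges; apply: subset_leq_card.
apply/subsetP => g /long_edge_left[k /andP[ik /eqP <-] _].
by apply: imset_f; rewrite inE.
Qed.

(** The vertices found from the left and from the right end of [least_over k] both have this edge as
    their least edge, so injectivity identifies both with [k]. *)
Lemma apex_least_over k : inner k -> apex T (least_over k) k.
Proof.
move=> ik; have [lT lk _] := least_overP ik.
have gD : least_over k \in long_edges by rewrite inE lT; elia.
have [k1 /andP[i1 /eqP e1] T1] := long_edge_left gD.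
have [k2 /andP[i2 /eqP e2] T2] := long_edge_right gD.
have k1k : k1 = k by apply: least_over_inj; rewrite ?inE.
have k2k : k2 = k by apply: least_over_inj; rewrite ?inE.
by rewrite k1k in T1; rewrite k2k in T2; rewrite /apex lT lk T1 T2.
Qed.

Lemma apex_inner g k : apex T g k -> inner k.
Proof. by case/and4P=> h _ _ _; rewrite /inner; have := ltn_ord g.2; lia. Qed.

Lemma apexE g k : apex T g k -> g = least_over k.
Proof.
move=> ap; have ik := apex_inner ap; symmetry.
case/and4P: ap => gk gT lT rT; apply: least_over_eq => // f fT fk.
have := @tri_noncrossing (g.1, k) f lT fT; have := @tri_noncrossing f (k, g.2) fT rT.
by rewrite /= => h1 h2; apply/andP; split; apply: contraT => ?; exfalso; elia.
Qed.

(** Let [g] be the shortest edge strictly containing [f]. Its apex cannot lie strictly under [f],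
    since then [f] would contain [g]; so [f] lies within one lower edge of the triangle below [g],
    and minimality makes them equal. *)
Lemma edge_parent f : f \in T -> f != root_edge n ->
  exists g k, apex T g k /\ (f = fL (g, k) \/ f = fR (g, k)).
Proof.
move=> fT fr; pose P g := [&& g \in T, g.1 <= f.1, f.2 <= g.2 & g != f].
have P0 : P (root_edge n).
  by rewrite /P root_edge_in eq_sym fr /= -ltnS ltn_ord.
case: (@arg_minnP _ _ P (fun g => g.2 - g.1) P0) => g /and4P[gT g1 g2 gf] gmin.
have flt := tri_lt fT.
have gD : g \in long_edges.
  rewrite inE gT /=; apply: contraT => hg; exfalso; move/negP: gf; apply; apply/eqP.
  case: g f {P P0 gmin fr fT gT} g1 g2 hg flt => [a b] [c d] /= *.
  by congr pair; apply: val_inj => /=; elia.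
have [k /andP[ik /eqP ek] _] := long_edge_left gD.
have ap := apex_least_over ik; rewrite ek in ap; exists g, k; split=> //.
have [_ _ lmin] := least_overP ik; rewrite ek in lmin.
case/and4P: ap => gk _ lT rT.
have nk : (k <= f.1) || (f.2 <= k).
  apply: contraT => hn; exfalso; have fk : f.1 < k < f.2 by elia.
  have h := lmin f fT fk.
  move/negP: gf; apply; apply/eqP; clear -g1 g2 h.
  case: g f g1 g2 h => [a b] [c d] /= *.
  by congr pair; apply: val_inj => /=; elia.
case/orP: nk => hk; [right|left]; apply/eqP; rewrite eq_sym; apply: contraT => ne.
  have : P (fR (g, k)) by rewrite /P /= rT hk g2 ne.
  by move/gmin => /=; elia.
have : P (fL (g, k)) by rewrite /P /= lT hk g1 ne.
by move/gmin => /=; elia.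
Qed.

Lemma apex_step g k : apex T g k ->
  dist_step T g (fL (g, k)) /\ dist_step T g (fR (g, k)).
Proof.
by move=> ap; split; apply/existsP; exists k; rewrite ap eqxx ?orbT.
Qed.

(** Parents are longer, so induction from the longest edges downwards shows that the recursive
    decomposition reaches every edge. *)
Lemma tri_distinguished f : f \in T -> distinguished T f.
Proof.
have [m] := ubnP (n.+1 - (f.2 - f.1)); elim: m f => // m IHm f hm fT.
have [->|fr] := eqVneq f (root_edge n); first exact: connect0.
have [g [k [ap e]]] := edge_parent fT fr.
have gT : g \in T by case/and4P: ap.
have hg : distinguished T g.
  apply: IHm => //; case/and4P: ap => gk _ _ _.
  by have := ltn_ord g.2; case: e => ef; rewrite ef /= in hm; elia.
apply: connect_trans hg _; apply: connect1.
by have [sL sR] := apex_step ap; case: e => ->.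
Qed.

Lemma trianglesE t : (t \in triangles T) = (inner t.2 && (t.1 == least_over t.2)).
Proof.
rewrite inE; apply/andP/andP => [[_ ap]|[ik /eqP e]].
  by rewrite (apex_inner ap) -(apexE ap).
have ap := apex_least_over ik; rewrite -e in ap; split=> //.
by apply: tri_distinguished; case/and4P: ap.
Qed.

Lemma kLE k : inner k -> kL T k = (least_over k).1.
Proof.
move=> ik; rewrite /kL; have [_ lk _] := least_overP ik.
have hin x : ((x, k) \in Ledges T) = (x == (least_over k).1).
  apply/imsetP/eqP => [[t]|->]; last first.
    by exists (least_over k, k) => //; rewrite trianglesE /= ik eqxx.
  by rewrite trianglesE => /andP[_ /eqP e] [-> ->]; rewrite -e.
case: pickP => [x /andP[_]|/(_ (least_over k).1)]; rewrite hin ?eqxx ?andbT; first by move/eqP.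
by case/andP: lk => ->.
Qed.

Lemma kRE k : inner k -> kR T k = (least_over k).2.
Proof.
move=> ik; rewrite /kR; have [_ lk _] := least_overP ik.
have hin x : ((k, x) \in Redges T) = (x == (least_over k).2).
  apply/imsetP/eqP => [[t]|->]; last first.
    by exists (least_over k, k) => //; rewrite trianglesE /= ik eqxx.
  by rewrite trianglesE => /andP[_ /eqP e] [-> ->]; rewrite -e.
case: pickP => [x /andP[_]|/(_ (least_over k).2)]; rewrite hin ?eqxx ?andbT; first by move/eqP.
by case/andP: lk => _ ->.
Qed.

Definition kLR (k : vtx n) : edge n := (kL T k, kR T k).

Lemma kLRE k : inner k -> kLR k = least_over k.
Proof. by move=> ik; rewrite /kLR kLE // kRE // -surjective_pairing. Qed.

Lemma kLR_lt k : inner k -> kL T k < k < kR T k.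
Proof. by move=> ik; rewrite kLE // kRE //; have [] := least_overP ik. Qed.

Lemma kLR_inj k j : inner k -> inner j -> kLR k = kLR j -> k = j.
Proof. by move=> ik ij; rewrite !kLRE //; apply: least_over_inj; rewrite inE. Qed.

Lemma kLR_parent k : inner k -> kLR k = root_edge n \/
  exists2 p, inner p & kLR k = (kL T p, p) \/ kLR k = (p, kR T p).
Proof.
move=> ik; have [->|ne] := eqVneq (kLR k) (root_edge n); [by left|right].
have [lT _ _] := least_overP ik; rewrite -kLRE // in lT.
have [g [p [ap e]]] := edge_parent lT ne; have ip := apex_inner ap.
by exists p => //; rewrite kLE // kRE // -(apexE ap).
Qed.

(** Otherwise the upper edges [(kL T j, k)] and [(j, kR T k)] would cross. *)
Lemma LedgesN_Redges k j : inner k -> inner j -> (kL T k, k) = (j, kR T j) -> False.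
Proof.
move=> ik ij [e1 e2]; have [kT hk _] := least_overP ik; have [jT hj _] := least_overP ij.
rewrite kLE // in e1; rewrite kRE // in e2.
have := tri_noncrossing jT kT.
move/(congr1 (@nat_of_ord _)): e1; move/(congr1 (@nat_of_ord _)): e2; elia.
Qed.

Lemma trianglesP t : (t \in triangles T) = (inner t.2 && (t == (kLR t.2, t.2))).
Proof.
rewrite trianglesE; case: t => g k /=; rewrite xpair_eqE eqxx andbT.
by apply: andb_id2l => ik; rewrite kLRE.
Qed.

End TriangulationFacts.

(** * Generators of the fan *)

Section Dot.
Variable d : nat.
Implicit Types m u : 'rV[int]_d.

Definition dot m u : int := \sum_i m 0 i * u 0 i.

Lemma dotDl m m' u : dot (m + m') u = dot m u + dot m' u.
Proof. by rewrite /dot -big_split; apply: eq_bigr => i _; rewrite !mxE mulrDl. Qed.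

Lemma dotDr m u u' : dot m (u + u') = dot m u + dot m u'.
Proof. by rewrite /dot -big_split; apply: eq_bigr => i _; rewrite !mxE mulrDr. Qed.

Lemma dotZl c m u : dot (c *: m) u = c * dot m u.
Proof. by rewrite /dot big_distrr; apply: eq_bigr => i _; rewrite /= !mxE mulrA. Qed.

Lemma dotZr c m u : dot m (c *: u) = c * dot m u.
Proof. by rewrite /dot big_distrr; apply: eq_bigr => i _; rewrite /= !mxE mulrCA. Qed.

Lemma dotNl m u : dot (- m) u = - dot m u.
Proof. by rewrite -scaleN1r dotZl mulN1r. Qed.

Lemma dotNr m u : dot m (- u) = - dot m u.
Proof. by rewrite -scaleN1r dotZr mulN1r. Qed.

Lemma dotBr m u u' : dot m (u - u') = dot m u - dot m u'.
Proof. by rewrite dotDr dotNr. Qed.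

Lemma dot0l u : dot 0 u = 0.
Proof. by rewrite /dot big1 // => i _; rewrite mxE mul0r. Qed.

Lemma dot0r m : dot m 0 = 0.
Proof. by rewrite /dot big1 // => i _; rewrite mxE mulr0. Qed.

Lemma dot_sumr I (r : seq I) (F : I -> 'rV[int]_d) m :
  dot m (\sum_(i <- r) F i) = \sum_(i <- r) dot m (F i).
Proof. by apply: (big_morph (dot m)); [apply: dotDr | apply: dot0r]. Qed.

Lemma dot_delta m i : dot m (delta_mx 0 i) = m 0 i.
Proof.
rewrite /dot (bigD1 i) //= big1 => [|j ji]; rewrite mxE eqxx ?eqxx ?mulr1 ?addr0 //=.
by rewrite (negPf ji) mulr0.
Qed.

Lemma dotC_delta u i : dot (delta_mx 0 i) u = u 0 i.
Proof.
rewrite -[RHS]dot_delta /dot; apply: eq_bigr => j _; exact: mulrC.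
Qed.

End Dot.

(** * Edge vectors, recursion from the root, and separating functionals *)

Section Vectors.
Variables (n : nat) (T : {set edge n}).

Definition inner_vtx (i : 'I_n) : vtx n := widen_ord (leqnSn n.+1) (lift ord0 i).

Lemma inner_vtxE i : inner_vtx i = i.+1 :> nat.
Proof. by []. Qed.

Lemma inner_inner_vtx i : inner (inner_vtx i).
Proof. by rewrite /inner inner_vtxE /=; have := ltn_ord i. Qed.

Lemma inner_vtx_inj : injective inner_vtx.
Proof. by move=> i j /(congr1 val) /= [/val_inj]. Qed.

Lemma inner_vtxP (k : vtx n) : inner k -> exists i, k = inner_vtx i.
Proof.
move=> /andP[k0 k1]; have h : (k.-1 < n)%N by lia.
by exists (Ordinal h); apply: val_inj; rewrite /= /bump /=; lia.
Qed.

Lemma not_inner (k : vtx n) : ~~ inner k -> k = ord0 \/ k = ord_max.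
Proof.
rewrite /inner => h; have [k0|k0] := posnP k; [left|right]; apply: val_inj => //=.
by rewrite k0 /= in h; have := ltn_ord k; lia.
Qed.

(** In the coordinates given by consecutive differences, the [varpi k] for inner [k] are the
    standard basis, and the two ends of the root edge give 0. *)
Lemma varpiE (k : vtx n) (i : 'I_n) : varpi k 0 i = (k == inner_vtx i)%:R.
Proof.
rewrite !mxE.
have e (j : 'I_n.+1) :
    (\sum_(k0 < n.+1 | (k0 < k)%N) (delta_mx 0 k0 : 'rV[int]_n.+1)) 0 j = (j < k)%N%:R.
  rewrite summxE; case: ltnP => jk.
    rewrite (bigD1 j) //= mxE !eqxx big1 ?addr0 // => l /andP[_ lj].
    by rewrite mxE eqxx eq_sym (negPf lj).
  rewrite big1 // => l lk; rewrite mxE eqxx /=; case: eqP => // jl; subst; lia.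
rewrite !e -val_eqE /= /bump leq0n add1n.
by case: (ltngtP k i.+1) => h; case: (ltnP i k) => h2 //; lia.
Qed.

Lemma varpi0 : varpi ord0 = 0 :> 'rV[int]_n.
Proof. by apply/rowP => i; rewrite varpiE mxE. Qed.

Lemma varpi_max : varpi ord_max = 0 :> 'rV[int]_n.
Proof.
apply/rowP => i; rewrite varpiE mxE -val_eqE /= /bump /= add1n.
by have := ltn_ord i; case: eqP => // e; lia.
Qed.

Definition edgevec (f : edge n) : 'rV[int]_n := varpi f.1 - varpi f.2.

Lemma edgevecE f i :
  edgevec f 0 i = (f.1 == inner_vtx i)%:R - (f.2 == inner_vtx i)%:R.
Proof. by rewrite /edgevec mxE [X in _ + X]mxE !varpiE. Qed.

Lemma edgevec_root : edgevec (root_edge n) = 0.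
Proof. by rewrite /edgevec varpi0 varpi_max subr0. Qed.

(** The entry 1 marks the first end and the entry -1 the second. An end that leaves no entry is 0 or
    n+1, and the order of the ends decides which. *)
Lemma edgevec_inj (f g : edge n) : (f.1 < f.2)%N -> (g.1 < g.2)%N ->
  edgevec f = edgevec g -> f = g.
Proof.
case: f g => [a b] [c d] /= ab cd e.
have {}e (k : vtx n) : inner k ->
    (a == k)%:R - (b == k)%:R = (c == k)%:R - (d == k)%:R :> int.
  by move=> /inner_vtxP[i ->]; move/rowP/(_ i): e; rewrite !edgevecE.
have neq (x y : vtx n) : (x < y)%N -> (x == y) = false /\ (y == x) = false.
  by move=> xy; rewrite -!val_eqE /=; split; apply/eqP => ?; lia.
have [nab nba] := neq _ _ ab; have [ncd ndc] := neq _ _ cd.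
have fst_eq : inner a || inner c -> a = c.
  case/orP => /e; rewrite eqxx ?nba ?ndc.
    by case: (eqVneq a c) => // _; case: (d == a).
  by case: (eqVneq a c) => // _; case: (b == c).
have snd_eq : inner b || inner d -> b = d.
  case/orP => /e; rewrite eqxx ?nab ?ncd.
    by case: (eqVneq b d) => // _; case: (c == b).
  by case: (eqVneq b d) => // _; case: (a == d).
have := ltn_ord b; have := ltn_ord d => hd hb.
congr pair.
  case h: (inner a || inner c); first exact: fst_eq.
  move/negbT: h; rewrite negb_or => /andP[/not_inner[->|ea] /not_inner[->|ec]] //; exfalso.
  - by rewrite ec /= in cd; lia.
  - by rewrite ea /= in ab; lia.
  - by rewrite ea /= in ab; lia.
case h: (inner b || inner d); first exact: snd_eq.
move/negbT: h; rewrite negb_or => /andP[/not_inner[eb|->] /not_inner[ed|->]] //; exfalso.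
- by rewrite eb in ab.
- by rewrite eb in ab.
- by rewrite ed in cd.
Qed.

Lemma edgevec_neq0 (f : edge n) : (f.1 < f.2)%N -> f != root_edge n ->
  exists i, `|edgevec f 0 i| = 1.
Proof.
case: f => [a b] /= ab ne.
have : inner a || inner b.
  apply: contraT; rewrite negb_or => /andP[/not_inner ha /not_inner hb]; exfalso.
  by case: ha hb => ea [] eb; move: ab ne; rewrite ea eb ?eqxx //= ltnn.
by case/orP => /inner_vtxP[i ei]; exists i; rewrite edgevecE /= -ei eqxx;
  case: eqP => // e; subst; rewrite ltnn in ab.
Qed.

Lemma vwvec k : vvec T k + wvec T k = edgevec (kLR T k).
Proof. by rewrite /vvec /wvec /edgevec /= [_ + (_ - _)]addrC addrA subrK. Qed.

Definition child_edge (k : vtx n) (b : bool) : edge n :=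
  if b then (k, kR T k) else (kL T k, k).

Definition gen (k : vtx n) (b : bool) : 'rV[int]_n :=
  if b then vvec T k else wvec T k.

Lemma genE k b : gen k b = edgevec (child_edge k b).
Proof. by case: b. Qed.

Hypotheses (n_gt0 : (0 < n)%N) (hT : is_triangulation T).

Lemma child_edge_lt k b : inner k -> ((child_edge k b).1 < (child_edge k b).2)%N.
Proof. by move=> ik; have /andP[h1 h2] := kLR_lt n_gt0 hT ik; case: b. Qed.

Lemma child_edge_root k b : inner k -> child_edge k b != root_edge n.
Proof.
move=> /andP[k0 k1]; case: b; apply/eqP => -[].
  by move=> /(congr1 val) /= e; rewrite e in k0.
by move=> _ /(congr1 val) /= e; rewrite e ltnn in k1.
Qed.

Lemma child_edge_inj k b j c : inner k -> inner j ->
  child_edge k b = child_edge j c -> k = j /\ b = c.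
Proof.
move=> ik ij; case: b; case: c => /= e.
- by case: e.
- by case: (LedgesN_Redges n_gt0 hT ij ik (esym e)).
- by case: (LedgesN_Redges n_gt0 hT ik ij e).
- by case: e.
Qed.

Lemma gen_inj k b j c : inner k -> inner j -> gen k b = gen j c -> k = j /\ b = c.
Proof.
move=> ik ij; rewrite !genE => /edgevec_inj e; apply: child_edge_inj => //.
by apply: e; apply: child_edge_lt.
Qed.

Lemma gen_parent k : inner k ->
  gen k true + gen k false = 0 \/
  exists p b, inner p /\ kLR T k = child_edge p b.
Proof.
move=> ik; rewrite vwvec; case: (kLR_parent n_gt0 hT ik) => [->|[p ip e]].
  by left; rewrite edgevec_root.
by right; case: e => e; exists p; [exists false|exists true].
Qed.

Lemma kLR_lt2 k : inner k -> ((kLR T k).1 < (kLR T k).2)%N.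
Proof. by move=> ik; have /andP[h1 h2] := kLR_lt n_gt0 hT ik; apply: ltn_trans h2. Qed.

Lemma gen_sum_child k p b : inner k -> inner p ->
  gen k true + gen k false = gen p b -> kLR T k = child_edge p b.
Proof.
move=> ik ip; rewrite vwvec genE => /edgevec_inj; apply.
  exact: kLR_lt2.
exact: child_edge_lt.
Qed.

Lemma gen_sum_inj k j : inner k -> inner j ->
  gen k true + gen k false = gen j true + gen j false -> k = j.
Proof.
move=> ik ij; rewrite !vwvec => /edgevec_inj e; apply: (kLR_inj n_gt0 hT) => //.
by apply: e; exact: kLR_lt2.
Qed.

(** This is the form in which primitivity of the generators is used. *)
Lemma gen_neq0 k b : inner k -> exists i, `|gen k b 0 i| = 1.
Proof.
move=> ik; rewrite genE; apply: edgevec_neq0 (child_edge_root b ik).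
exact: child_edge_lt.
Qed.

(** The length of the upper edge of the triangle with apex [k]: the measure for inductions from the
    root downwards. *)
Definition len (k : vtx n) : nat := (kR T k - kL T k)%N.

Lemma len_child k p b : inner k -> inner p -> kLR T k = child_edge p b -> (len k < len p)%N.
Proof.
move=> ik ip; have /andP[h1 h2] := kLR_lt n_gt0 hT ip.
by case: b => -[e1 e2]; rewrite /len e1 e2; lia.
Qed.

(** The upper edge of [k] is a lower edge of its parent [p], so one of its ends is [p] and the other
    is an end of the upper edge of [p], to which the induction applies. *)
Lemma len_anc k : inner k ->
  (inner (kL T k) -> (len k < len (kL T k))%N) /\
  (inner (kR T k) -> (len k < len (kR T k))%N).
Proof.
have [m] := ubnP (n.+1 - len k); elim: m k => // m IHm k hm ik.
case: (kLR_parent n_gt0 hT ik) => [[-> ->]|[p ip e]].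
  by split=> /andP[]; rewrite //= ltnn.
have lt : (len k < len p)%N.
  by case: e => e; [apply: (@len_child k p false)|apply: (@len_child k p true)].
have hp : (len p <= n.+1)%N by rewrite /len leq_subLR; have := ltn_ord (kR T p); lia.
have [|hl hr] := IHm p _ ip; first by lia.
by case: e => -[-> ->]; split=> // i; apply: ltn_trans lt _; auto.
Qed.

Lemma tri_rec (V : Type) (z : V) (c : vtx n -> V -> V -> V) :
  exists h : vtx n -> V, [/\ h ord0 = z, h ord_max = z
    & forall k, inner k -> h k = c k (h (kL T k)) (h (kR T k))].
Proof.
pose H j := iter j (fun f k => if inner k then c k (f (kL T k)) (f (kR T k)) else z)
  (fun=> z).
have Hz j k : ~~ inner k -> H j k = z by case: j => //= j /negPf ->.
have st i j k : (n.+2 - len k < i)%N -> (n.+2 - len k < j)%N -> H i k = H j k.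
  elim: i j k => // i IHi [] // j k hi hj /=; case: ifP => // ik.
  have [hl hr] := len_anc ik.
  have hk : (len k <= n.+1)%N by rewrite /len leq_subLR; have := ltn_ord (kR T k); lia.
  congr (c k _ _).
    case ikl: (inner (kL T k)); last by rewrite !Hz ?ikl.
    by have lt := hl ikl; apply: IHi; lia.
  case ikr: (inner (kR T k)); last by rewrite !Hz ?ikr.
  by have lt := hr ikr; apply: IHi; lia.
(* By [st] the iteration is stationary at [k] after more than [n.+2 - len k] rounds, so rounds
   [n.+3] and [n.+4] agree. *)
exists (H n.+4); split; [exact: Hz | by rewrite Hz // /inner /= ltnn |].
move=> k ik.
have -> : H n.+4 k = if inner k then c k (H n.+3 (kL T k)) (H n.+3 (kR T k)) else z by [].
by rewrite ik; congr (c k _ _); apply: st; lia.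
Qed.

(** The functional with potential [h]: its values on edge vectors are differences of [h], once [h]
    vanishes at both ends of the root edge. *)
Definition pot (h : vtx n -> int) : 'rV[int]_n := \row_i h (inner_vtx i).

Lemma dot_pot h k : h ord0 = 0 -> h ord_max = 0 -> dot (pot h) (varpi k) = h k.
Proof.
move=> h0 hm; case ik: (inner k).
  have [i ->] := inner_vtxP ik; rewrite /dot (bigD1 i) //= varpiE eqxx mxE mulr1.
  rewrite big1 ?addr0 // => j ji; rewrite varpiE.
  by rewrite (inj_eq inner_vtx_inj) eq_sym (negPf ji) mulr0.
by case: (not_inner (negbT ik)) => ->; rewrite ?varpi0 ?varpi_max dot0r ?h0 ?hm.
Qed.

(** The value on the upper edge of a triangle is fixed by the potential at [kL] and [kR] before the
    potential at [k] is chosen. So [c] may split this value between the two lower edges at will. *)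
Lemma functional_rec (c : vtx n -> int -> int) :
  exists m : 'rV[int]_n, forall k, inner k ->
    dot m (gen k true) = c k (dot m (gen k true + gen k false)).
Proof.
have [h [h0 hm hk]] := tri_rec 0 (fun k l r => r + c k (l - r)).
exists (pot h) => k ik; rewrite vwvec /gen /vvec /edgevec !dotBr !dot_pot //=.
by rewrite {1}hk // [_ + c _ _]addrC addrK.
Qed.

Definition valid (Q : seq 'rV[int]_n) : Prop :=
  (forall q, q \in Q -> exists2 k : vtx n, inner k & q = vvec T k \/ q = wvec T k) /\
  (forall k : vtx n, inner k -> ~ (vvec T k \in Q /\ wvec T k \in Q)).

Lemma separation Q Q' : valid Q -> valid Q' -> exists m, [/\
  forall q, q \in Q -> 0 <= dot m q, forall q, q \in Q' -> dot m q <= 0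
  & forall q, q \in Q -> q \notin Q' -> 0 < dot m q].
Proof.
move=> [g2 v2] [g1 v1].
(* Here [y] is the value on the sum of the pair. A generator in both sets gets 0; one in [Q] only
   gets [|y| + 1], which makes its partner negative, as [Q'] may demand; if the pair misses [Q], a
   generator in [Q'] gets 0. *)
pose c k y : int :=
  if gen k true \in Q then if gen k true \in Q' then 0 else `|y| + 1
  else if gen k false \in Q then if gen k false \in Q' then y else y - `|y| - 1
  else if gen k false \in Q' then y else 0.
have [m hm] := functional_rec c; exists m.
have key k : inner k ->
  [/\ vvec T k \in Q -> 0 <= dot m (vvec T k), wvec T k \in Q -> 0 <= dot m (wvec T k),
    vvec T k \in Q' -> dot m (vvec T k) <= 0, wvec T k \in Q' -> dot m (wvec T k) <= 0 &
   (vvec T k \in Q -> vvec T k \notin Q' -> 0 < dot m (vvec T k)) /\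
   (wvec T k \in Q -> wvec T k \notin Q' -> 0 < dot m (wvec T k))].
  move=> ik; have := hm k ik; have := v1 k ik; have := v2 k ik.
  rewrite /c /gen dotDr.
  case: (vvec T k \in Q); case: (wvec T k \in Q); case: (vvec T k \in Q');
    case: (wvec T k \in Q') => //= h2 h1; try (by case: h2; split);
    try (by case: h1; split);
    move: (dot m (vvec T k)) (dot m (wvec T k)) => x y e;
    split=> //; try split=> //; intros; lia.
split=> q hq.
- have [k ik e] := g2 q hq; have [h1 h2 h3 h4 [h5 h6]] := key k ik.
  by case: e hq => ->; auto.
- have [k ik e] := g1 q hq; have [h1 h2 h3 h4 [h5 h6]] := key k ik.
  by case: e hq => ->; auto.
- have [k ik e] := g2 q hq; have [h1 h2 h3 h4 [h5 h6]] := key k ik.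
  by case: e hq => ->; auto.
Qed.

Definition basis (b : vtx n -> bool) : seq 'rV[int]_n :=
  [seq gen (inner_vtx i) (b (inner_vtx i)) | i <- enum 'I_n].

Lemma mem_basis b q :
  reflect (exists2 k, inner k & q = gen k (b k)) (q \in basis b).
Proof.
apply: (iffP mapP) => [[i _ ->]|[k /inner_vtxP[i ->] ->]].
  by exists (inner_vtx i) => //; apply: inner_inner_vtx.
by exists i => //; rewrite mem_enum.
Qed.

Lemma mem_basis_gen b k c : inner k -> (gen k c \in basis b) = (b k == c).
Proof.
move=> ik; apply/mem_basis/eqP => [[j ij /gen_inj[] // -> ->]|<-] //.
by exists k.
Qed.

Lemma basis_valid b : valid (basis b).
Proof.
split=> [q /mem_basis[k ik ->]|k ik].
  by exists k => //; rewrite /gen; case: (b k); [left|right].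
rewrite -/(gen k true) -/(gen k false) !mem_basis_gen //.
by case: (b k) => -[].
Qed.

Definition basis_mx (b : vtx n -> bool) : 'M[int]_n :=
  \matrix_(i, j) gen (inner_vtx i) (b (inner_vtx i)) 0 j.

Lemma row_basis_mx b i : row i (basis_mx b) = gen (inner_vtx i) (b (inner_vtx i)).
Proof. by apply/rowP => j; rewrite !mxE. Qed.

(** [functional_rec] provides the dual basis: functionals equal to 1 on one chosen generator and to
    0 on the other chosen ones. They form an integer inverse. *)
Lemma basis_unit b : basis_mx b \in unitmx.
Proof.
have dual (k0 : 'I_n) : exists m, forall i,
    dot m (gen (inner_vtx i) (b (inner_vtx i))) = (k0 == i)%:R.
  pose e k : int := (k == inner_vtx k0)%:R.
  have [m hm] := functional_rec (fun k y => if b k then e k else y - e k).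
  exists m => i; have := hm _ (inner_inner_vtx i).
  rewrite /e (inj_eq inner_vtx_inj) eq_sym; rewrite dotDr.
  by case: (b _) => // h; lra.
have [m hm] := fin_all_exists dual.
have : basis_mx b *m (\matrix_(i, j) m i 0 j)^T = 1%:M.
  apply/matrixP => i j; rewrite !mxE -(eq_sym j) -hm /dot.
  by apply: eq_bigr => k _; rewrite !mxE mulrC.
by case/mulmx1_unit.
Qed.

Lemma varpi_inner_vtx i : varpi (inner_vtx i) = delta_mx 0 i :> 'rV[int]_n.
Proof.
apply/rowP => j; rewrite varpiE mxE eqxx /= (inj_eq inner_vtx_inj).
by rewrite eq_sym.
Qed.

End Vectors.
(** * Isomorphisms of unordered trees *)

Definition sibling n (T : {set edge n}) (q1 q2 : 'rV[int]_n) : Prop :=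
  exists k b, [/\ inner k, q1 = gen T k b & q2 = gen T k (~~ b)].

Definition sib_mx n (T T' : {set edge n}) (A : 'M[int]_n) : Prop :=
  forall q1 q2, sibling T q1 q2 <-> sibling T' (q1 *m A) (q2 *m A).

(** The intermediate notion through which fan, toric and tree isomorphisms are compared. As every
    generator has a sibling, such a matrix permutes the generators as well. *)
Definition sib_iso n (T T' : {set edge n}) : Prop :=
  exists2 A : 'M[int]_n, A \in unitmx & sib_mx T T' A.

Section Tree.
Variables (n : nat) (T : {set edge n}).
Hypotheses (n_gt0 : (0 < n)%N) (hT : is_triangulation T).

Definition gsum (k : vtx n) : 'rV[int]_n := gen T k true + gen T k false.

Definition tri (k : vtx n) : edge n * vtx n := (kLR T k, k).

Lemma gsumE k : gsum k = edgevec (kLR T k). Proof. exact: vwvec. Qed.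

Lemma tri_in k : inner k -> tri k \in triangles T.
Proof. by move=> ik; rewrite trianglesP // ik eqxx. Qed.

Lemma tri_inv t : t \in triangles T -> inner t.2 /\ t = tri t.2.
Proof. by rewrite trianglesP // => /andP[-> /eqP]. Qed.

Lemma card_triangles : #|triangles T| = n.
Proof.
rewrite -[RHS](card_inner n); have -> : triangles T = tri @: [set k : vtx n | inner k].
  apply/setP => t; apply/idP/imsetP => [/tri_inv[it ->]|[k]].
    by exists t.2 => //; rewrite inE.
  by rewrite inE => ik ->; apply: tri_in.
by rewrite card_imset // => i j [].
Qed.

Lemma root_gsum k : inner k -> bt_root (binary_tree T) (tri k) = (gsum k == 0).
Proof.
move=> ik /=; rewrite tri_in //= /has_edge !inE /=.
have h b : (root_edge n == child_edge T k b) = false.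
  by apply/negbTE; rewrite eq_sym child_edge_root.
rewrite (h false) (h true) !orbF gsumE; apply/eqP/eqP => [<-|e].
  by rewrite edgevec_root.
have : edgevec (root_edge n) = edgevec (kLR T k) by rewrite edgevec_root e.
by apply: edgevec_inj => //; apply: (kLR_lt2 n_gt0 hT).
Qed.

(** This makes the tree relation a linear equation, which a matrix can transport. An edge is a lower
    edge of only one triangle, so any other triangle containing it has it as upper edge. *)
Lemma has_child_edge k j b : inner k -> inner j ->
  (tri j != tri k) && has_edge (tri j) (child_edge T k b) = (gsum j == gen T k b).
Proof.
move=> ik ij; apply/andP/eqP => [[ne]|e].
  rewrite /has_edge !inE => /or3P[/eqP e|/eqP e|/eqP e].
  - by rewrite gsumE genE e.
  - have [ejk _] := @child_edge_inj _ _ n_gt0 hT _ _ _ false ik ij e.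
    by rewrite ejk eqxx in ne.
  - have [ejk _] := @child_edge_inj _ _ n_gt0 hT _ _ _ true ik ij e.
    by rewrite ejk eqxx in ne.
have {}e := gen_sum_child n_gt0 hT ij ik e.
have lt := len_child n_gt0 hT ij ik e.
split; last by rewrite /has_edge inE /= e eqxx.
by apply: contraTneq lt => -[_ _ ->]; rewrite ltnn.
Qed.

Lemma child_gsum k j : inner k -> inner j -> bt_child (binary_tree T) (tri k) (tri j) =
  (gsum j == gen T k true) || (gsum j == gen T k false).
Proof.
by move=> ik ij; rewrite -!has_child_edge // /bt_child /= !tri_in //= orbC.
Qed.

End Tree.

Section SibIsoTree.
Variables (n : nat) (T T' : {set edge n}).
Hypotheses (n_gt0 : (0 < n)%N) (hT : is_triangulation T) (hT' : is_triangulation T').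

(** A matrix that carries pairs to pairs carries their sums to sums, and the tree is read off from
    the equations between sums and generators. *)
Lemma sib_iso_unordered_iso :
  sib_iso T T' -> unordered_iso (binary_tree T) (binary_tree T').
Proof.
case=> A uA hA.
have mulI (u v : 'rV[int]_n) : (u *m A == v *m A) = (u == v).
  by apply/eqP/eqP => [e|->//]; rewrite -(mulmxK uA u) e mulmxK.
(* [p.1] is the apex of the image pair, and [p.2] is [false] exactly when left and right are
   exchanged. *)
have /choice[f hf] : forall k : vtx n, exists p : vtx n * bool, inner k ->
    inner p.1 /\ forall c, gen T k c *m A = gen T' p.1 (c == p.2).
  move=> k; case ik: (inner k); last by exists (k, true).
  have [|j [b [ij e1 e2]]] := (hA (gen T k true) (gen T k false)).1; first by exists k, true.
  by exists (j, b) => _; split=> // -[]; rewrite ?e1 ?e2.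
have sumA k : inner k -> gsum T k *m A = gsum T' (f k).1.
  move=> /hf[_ h]; rewrite /gsum mulmxDl !h; case: (f k).2 => //=.
  by rewrite addrC.
have finj k j : inner k -> inner j -> (f k).1 = (f j).1 -> k = j.
  move=> ik ij e; apply: (gen_sum_inj n_gt0 hT ik ij).
  by apply/eqP; rewrite -mulI -/(gsum T k) -/(gsum T j) !sumA // e.
pose F (t : edge n * vtx n) := tri T' (f t.2).1.
have Finj : {in triangles T &, injective F}.
  move=> t1 t2 /(tri_inv n_gt0 hT)[i1 ->] /(tri_inv n_gt0 hT)[i2 ->] [_ _ /finj e].
  by rewrite e.
exists F; split=> //.
- rewrite /=; apply/eqP; rewrite eqEcard card_in_imset // !card_triangles // leqnn andbT.
  apply/subsetP => _ /imsetP[t /(tri_inv n_gt0 hT)[it _] ->].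
  by apply: tri_in => //; case: (hf _ it).
- move=> t /(tri_inv n_gt0 hT)[it ->].
  rewrite /F !root_gsum //=; last by case: (hf _ it).
  by rewrite -sumA // -[0 in LHS](mul0mx _ A) mulI.
move=> t1 t2 /(tri_inv n_gt0 hT)[i1 ->] /(tri_inv n_gt0 hT)[i2 ->].
have hc k j : inner k -> inner j -> bt_child (binary_tree T') (tri T' (f k).1) (tri T' (f j).1)
    = bt_child (binary_tree T) (tri T k) (tri T j).
  move=> ik ij; have [fk hk] := hf _ ik; have [fj _] := hf _ ij.
  rewrite !child_gsum // -2!(mulI (gsum T j)) !hk sumA //.
  by case: (f k).2 => //=; rewrite orbC.
by rewrite /bt_edge /F /= !hc.
Qed.

Lemma unordered_iso_sib_iso :
  unordered_iso (binary_tree T) (binary_tree T') -> sib_iso T T'.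
Proof.
case=> F [Finj Fim Froot Fedge].
pose f k := (F (tri T k)).2.
have hF k : inner k -> inner (f k) /\ F (tri T k) = tri T' (f k).
  by move=> ik; apply: (tri_inv n_gt0 hT'); rewrite -[triangles T']Fim imset_f ?tri_in.
have finj k j : inner k -> inner j -> f k = f j -> k = j.
  move=> ik ij e; have [_ ek] := hF k ik; have [_ ej] := hF j ij.
  by have [] : tri T k = tri T j by apply: Finj; rewrite ?tri_in // ek ej e.
have fsurj k : inner k -> exists2 j, inner j & f j = k.
  move=> ik; have : tri T' k \in triangles T' by rewrite tri_in.
  rewrite -[triangles T']Fim => /imsetP[t /(tri_inv n_gt0 hT)[it et] e].
  by exists t.2 => //; rewrite /f -et -e.
have froot k : inner k -> (gsum T' (f k) == 0) = (gsum T k == 0).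
  move=> ik; have [ifk ek] := hF k ik.
  by rewrite -root_gsum // -ek Froot ?root_gsum ?tri_in.
pose child (S : {set edge n}) k j := (gsum S j == gen S k true) || (gsum S j == gen S k false).
have childP S k j : reflect (exists b, gsum S j = gen S k b) (child S k j).
  apply: (iffP orP) => [[]/eqP e|[[] ->]]; [by exists true|by exists false|by left|by right].
have fedge k j : inner k -> inner j -> child T' (f k) (f j) || child T' (f j) (f k)
    = child T k j || child T j k.
  move=> ik ij; have [ifk ek] := hF k ik; have [ifj ej] := hF j ij.
  rewrite /child -!child_gsum // -ek -ej.
  by have := Fedge (tri T k) (tri T j); rewrite !tri_in // => /(_ isT isT).
have child_len k j : inner k -> inner j -> child T k j -> (len T j < len T k)%N.
  move=> ik ij /childP[b /(gen_sum_child n_gt0 hT ij ik)].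
  exact: len_child.
have parent_uniq S k j i : is_triangulation S -> inner k -> inner j ->
    child S k i -> child S j i -> k = j.
  move=> hS ik ij /childP[b e] /childP[c]; rewrite e => h.
  by have [] := gen_inj n_gt0 hS ik ij h.
have parentP k : inner k -> gsum T k = 0 \/ exists2 p, inner p & child T p k.
  move=> ik; case: (gen_parent n_gt0 hT ik) => [|[p [b [ip e]]]]; first by left.
  by right; exists p => //; apply/childP; exists b; rewrite gsumE genE e.
(* Edges are only preserved up to direction; the direction is recovered from the root downwards. If
   [f j] were the parent of [f k], then [k] is not the root, and its parent [p] satisfies
   [f p = f j] by induction, so [p = j], against the lengths. *)
have fchild k j : inner k -> inner j -> child T k j -> child T' (f k) (f j).
  have [m] := ubnP (n.+1 - len T k); elim: m k j => // m IHm k j hm ik ij ckj.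
  have [ifk _] := hF k ik; have [ifj _] := hF j ij.
  have := fedge k j ik ij; rewrite ckj /= => /orP[//|cjk]; exfalso.
  case: (parentP k ik) => [e|[p ip cpk]].
    have /eqP := froot k ik; rewrite e eqxx => /eqP/eqP e0.
    have [b e1] : exists b, 0 = gen T' (f j) b by rewrite -e0; apply/childP.
    have [i] := gen_neq0 n_gt0 hT' b ifj.
    by rewrite -e1 mxE normr0 => /esym/eqP; rewrite oner_eq0.
  have lpk := child_len _ _ ip ik cpk; have lkj := child_len _ _ ik ij ckj.
  have hp : (len T p <= n.+1)%N by rewrite /len leq_subLR; have := ltn_ord (kR T p); lia.
  have cfpk : child T' (f p) (f k) by apply: IHm => //; lia.
  have [ifp _] := hF p ip.
  by have /finj e := parent_uniq _ _ _ _ hT' ifp ifj cfpk cjk; rewrite e // in lpk; lia.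
(* The image of the left or right child decides which of the two edges below
   f p is the image of the left or right edge below p. *)
have orient p : inner p -> exists s : bool, forall k b, inner k -> gsum T k = gen T p b ->
    gsum T' (f k) = gen T' (f p) (b == s).
  move=> ip; have [ifp _] := hF p ip.
  have hch k b : inner k -> gsum T k = gen T p b ->
      exists c, gsum T' (f k) = gen T' (f p) c.
    move=> ik e; apply/childP/fchild => //.
    by apply/childP; exists b.
  have [[a [b [ia ea]]]|no] := pselect (exists k b, inner k /\ gsum T k = gen T p b).
    have [c ec] := hch a b ia ea; have [ifa _] := hF a ia.
    exists (b == c) => k b' ik ek; have [c' ec'] := hch k b' ik ek.
    rewrite ec'; congr (gen _ _ _).
    have [ifk _] := hF k ik.
    have eka : (k == a) = (b' == b).
      apply/eqP/eqP => [ka|eb].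
        by have [] := gen_inj n_gt0 hT ip ip (etrans (esym ek) (etrans (congr1 _ ka) ea)).
      by apply: (gen_sum_inj n_gt0 hT) => //; rewrite -!/(gsum _ _) ea ek eb.
    have eka' : (k == a) = (c' == c).
      apply/eqP/eqP => [ka|eb].
        have e : gen T' (f p) c' = gen T' (f p) c by rewrite -ec' ka.
        by have [] := gen_inj n_gt0 hT' ifp ifp e.
      by apply: finj => //; apply: (gen_sum_inj n_gt0 hT') => //; rewrite -!/(gsum _ _) ec ec' eb.
    by move: eka'; rewrite eka; case: b' b c' c {ek ec' eka ea ec} => [] [] [] [].
  by exists true => k b ik e; case: no; exists k, b.
have /choice[s hs] : forall p, exists s : bool, forall k b, inner p -> inner k ->
    gsum T k = gen T p b -> gsum T' (f k) = gen T' (f p) (b == s).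
  move=> p; case ip: (inner p); last by exists true.
  by have [s hs] := orient p ip; exists s => k b _; apply: hs.
(* [h k] is the intended image of [varpi k], chosen so that [vvec T k] goes to [gen T' (f k) (s k)].
   The image of the upper edge is known by induction to be [gsum T' (f k)], so [wvec T k] goes to
   the sibling. *)
have [h [h0 hm hk]] := tri_rec n_gt0 hT 0 (fun k _ r => r + gen T' (f k) (s k)).
have key k : inner k ->
    h (kL T k) - h k = gen T' (f k) (~~ s k) /\ h k - h (kR T k) = gen T' (f k) (s k).
  have [m] := ubnP (n.+1 - len T k); elim: m k => // m IHm k hlen ik.
  have e2 : h k - h (kR T k) = gen T' (f k) (s k).
    by rewrite {1}hk // addrC addKr.
  split=> //.
  have sumE : gsum T' (f k) = gen T' (f k) (~~ s k) + gen T' (f k) (s k).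
    by rewrite /gsum; case: (s k); rewrite // addrC.
  suff e : h (kL T k) - h (kR T k) = gsum T' (f k).
    by apply: (addIr (gen T' (f k) (s k))); rewrite -sumE -e -e2 addrA subrK.
  case: (kLR_parent n_gt0 hT ik) => [[eL eR]|[p ip e]].
    have /eqP -> : gsum T' (f k) == 0.
      by rewrite froot // gsumE /kLR eL eR -[(_, _)]/(root_edge n) edgevec_root.
    by rewrite eL eR h0 hm subrr.
  have [b eb] : exists b, kLR T k = child_edge T p b.
    by case: e => e; [exists false|exists true].
  have lt := len_child n_gt0 hT ik ip eb.
  have hp : (len T p <= n.+1)%N by rewrite /len leq_subLR; have := ltn_ord (kR T p); lia.
  have [|h1 h2] := IHm p _ ip; first by lia.
  rewrite (hs p k b) // ?gsumE ?genE ?eb //.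
  by case: b eb {e} => -[-> ->]; rewrite ?h1 ?h2; case: (s p).
pose A : 'M[int]_n := \matrix_i h (inner_vtx i).
have varpiA k : varpi k *m A = h k.
  case ik: (inner k); last by case: (not_inner (negbT ik)) => ->;
    rewrite ?varpi0 ?varpi_max ?h0 ?hm mul0mx.
  by have [i ->] := inner_vtxP ik; rewrite varpi_inner_vtx -rowE rowK.
have genA k b : inner k -> gen T k b *m A = gen T' (f k) (b == s k).
  move=> ik; have [k1 k2] := key k ik.
  by case: b; rewrite /= /vvec /wvec mulmxBl !varpiA ?k1 ?k2; case: (s k).
(* Surjectivity by descending induction on [k]: [varpi k] is [vvec T' k], the image of a generator,
   plus [varpi (kR T' k)] with [kR T' k] larger than [k]. *)
have /choice[B hB] : forall i : 'I_n, exists u : 'rV[int]_n, u *m A = delta_mx 0 i.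
  suff H (k : vtx n) : exists u : 'rV[int]_n, u *m A = varpi k.
    by move=> i; rewrite -varpi_inner_vtx.
  have [m] := ubnP (n.+1 - k); elim: m k => // m IHm k hkm.
  case ik: (inner k); last first.
    by exists 0; rewrite mul0mx; case: (not_inner (negbT ik)) => ->; rewrite ?varpi0 ?varpi_max.
  have /andP[_ ltR] := kLR_lt n_gt0 hT' ik.
  have [|u hu] := IHm (kR T' k).
    by have := ltn_ord (kR T' k); lia.
  have [j ij ej] := fsurj k ik.
  exists (gen T j (s j) + u); rewrite mulmxDl genA // ej hu eqxx /= /vvec.
  by rewrite subrK.
have uA : A \in unitmx.
  have : (\matrix_i B i) *m A = 1%:M.
    by apply/row_matrixP => i; rewrite row_mul rowK hB row1.
  by case/mulmx1_unit.
have mulI (u v : 'rV[int]_n) : u *m A = v *m A -> u = v.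
  by move=> e; rewrite -(mulmxK uA u) e mulmxK.
exists A => // q1 q2; split=> [[k [b [ik -> ->]]]|[k' [b [ik' e1 e2]]]].
  exists (f k), (b == s k); rewrite !genA //; split=> //; first by case: (hF k ik).
  by case: b; case: (s k).
have [k ik ek] := fsurj k' ik'.
exists k, (b == s k); split=> //; apply: mulI; rewrite ?e1 ?e2 genA // -ek.
  by congr gen; case: b {e1 e2}; case: (s k).
by congr gen; case: b {e1 e2}; case: (s k).
Qed.

End SibIsoTree.

(** * Isomorphisms of fans *)

From mathcomp Require Import complex classical_sets functions.

Section Cones.
Variables (R : realType) (d : nat).
Implicit Types (m u q : 'rV[int]_d) (Q : seq 'rV[int]_d) (A : 'M[int]_d).

Definition toR k l (M : 'M[int]_(k, l)) : 'M[R]_(k, l) := map_mx intr M.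

Definition img A (s : set 'rV[R]_d) : set 'rV[R]_d :=
  [set x *m map_mx intr A | x in s]%classic.

Lemma toR_inj k l : injective (@toR k l).
Proof.
by move=> M N /matrixP e; apply/matrixP => i j; have := e i j; rewrite !mxE => /intr_inj.
Qed.

Lemma scale_toR_entry c u v i :
  c *: toR u = toR v -> (v 0 i)%:~R = c * (u 0 i)%:~R.
Proof. by move=> /rowP/(_ i); rewrite !mxE. Qed.

Lemma pairing_toR m u : pairing m (toR u) = (dot m u)%:~R.
Proof.
by rewrite /pairing /dot rmorph_sum; apply: eq_bigr => i _; rewrite !mxE rmorphM.
Qed.

Lemma pairingDr m (x y : 'rV[R]_d) : pairing m (x + y) = pairing m x + pairing m y.
Proof. by rewrite /pairing -big_split; apply: eq_bigr => i _; rewrite !mxE mulrDr. Qed.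

Lemma pairingZr m c (x : 'rV[R]_d) : pairing m (c *: x) = c * pairing m x.
Proof. by rewrite /pairing big_distrr; apply: eq_bigr => i _; rewrite /= !mxE mulrCA. Qed.

Lemma pairing0r m : pairing m (0 : 'rV[R]_d) = 0.
Proof. by rewrite /pairing big1 // => i _; rewrite mxE mulr0. Qed.

Lemma pairingNl m (x : 'rV[R]_d) : pairing (- m) x = - pairing m x.
Proof. by rewrite /pairing -sumrN; apply: eq_bigr => i _; rewrite mxE rmorphN mulNr. Qed.

Lemma pairing_cone m Q x : (forall q, q \in Q -> 0 <= dot m q) ->
  @cone R _ Q x -> 0 <= pairing m x.
Proof.
move=> hQ [c [c0 ->]].
rewrite (big_morph (pairing m) (pairingDr m) (pairing0r m)).
rewrite big_seq; apply: sumr_ge0 => q qQ.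
by rewrite pairingZr -/(toR q) pairing_toR mulr_ge0 // ler0z hQ.
Qed.

Lemma mem_cone Q q : q \in Q -> @cone R _ Q (toR q).
Proof.
(* [Q] may repeat [q], so the coefficient 1 is shared among its occurrences. *)
move=> qQ; pose N : R := (count_mem q Q)%:R.
have N0 : N != 0 by rewrite pnatr_eq0 -lt0n -has_count has_pred1.
exists (fun p => (p == q)%:R / N); split.
  by move=> p; rewrite divr_ge0 ?ler0n.
rewrite (eq_bigr (fun p => ((p == q)%:R / N) *: toR q)); last first.
  by move=> p _; case: (eqVneq p q) => [->//|_]; rewrite mul0r !scale0r.
rewrite -scaler_suml -mulr_suml -natr_sum.
have -> : (\sum_(p <- Q) (p == q) = count_mem q Q)%N.
  by rewrite -sum1_count [RHS]big_mkcond; apply: eq_bigr => p _ /=; case: (p == q).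
by rewrite divff // scale1r.
Qed.

Lemma dual_coneP Q m : dual_monoid (@cone R _ Q) m <-> forall q, q \in Q -> 0 <= dot m q.
Proof.
split=> [h q /mem_cone /h|h x]; first by rewrite pairing_toR ler0z.
exact: pairing_cone.
Qed.

Lemma cone_nil : @cone R _ [::] = [set 0 : 'rV[R]_d]%classic.
Proof.
apply/seteqP; split=> x /=; first by case=> c [_ ->]; rewrite big_nil.
by move=> ->; exists (fun=> 0); split=> //; rewrite big_nil.
Qed.

Lemma img_mul A B s : img A (img B s) = img (B *m A) s.
Proof.
rewrite /img map_mxM; apply/seteqP; split=> x /=.
  by case=> y [z sz <-] <-; exists z => //; rewrite mulmxA.
by case=> z sz <-; exists (z *m map_mx intr B); [exists z | rewrite mulmxA].
Qed.

Lemma img1 s : img 1%:M s = s.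
Proof.
rewrite /img map_mx1; apply/seteqP; split=> x /=.
  by case=> y sy <-; rewrite mulmx1.
by move=> sx; exists x; rewrite // mulmx1.
Qed.

Lemma imgK A s : A \in unitmx -> img (invmx A) (img A s) = s.
Proof. by move=> uA; rewrite img_mul mulmxV // img1. Qed.

Lemma imgKV A s : A \in unitmx -> img A (img (invmx A) s) = s.
Proof. by move=> uA; rewrite img_mul mulVmx // img1. Qed.

Lemma img_cone A Q : A \in unitmx -> img A (@cone R _ Q) = @cone R _ [seq q *m A | q <- Q].
Proof.
move=> uA; apply/seteqP; split=> x /=.
  case=> y [c [c0 ->]] <-; exists (fun q => c (q *m invmx A)); split=> //.
  rewrite mulmx_suml big_map; apply: eq_bigr => q _.
  by rewrite mulmxK // -scalemxAl map_mxM.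
case=> c [c0 ->]; rewrite big_map.
exists (\sum_(q <- Q) c (q *m A) *: toR q); first by exists (fun q => c (q *m A)).
by rewrite mulmx_suml; apply: eq_bigr => q _; rewrite -scalemxAl map_mxM.
Qed.

End Cones.

Lemma sib_mxV n (T T' : {set edge n}) A : A \in unitmx ->
  sib_mx T T' A -> sib_mx T' T (invmx A).
Proof.
by move=> uA h q1 q2; rewrite h !mulmxKV.
Qed.

Lemma map_validP n (T T' : {set edge n}) A Q :
  sib_mx T T' A -> valid T Q -> valid T' [seq q *m A | q <- Q].
Proof.
move=> hA [gQ vQ]; split=> [q /mapP[p pQ ->]|k ik [/mapP[q1 Q1 e1] /mapP[q2 Q2 e2]]].
  have [k ik e] := gQ p pQ.
  have [b eb] : exists b, p = gen T k b by case: e => ->; [exists true|exists false].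
  have [|k' [b' [ik' e' _]]] := (hA p (gen T k (~~ b))).1; first by exists k, b.
  by exists k' => //; rewrite e' /gen; case: b' {e'}; [left|right].
have [|j [b [ij f1 f2]]] := (hA q1 q2).2; first by exists k, true; rewrite -e1 -e2.
by apply: (vQ j ij); subst; case: b Q1 Q2 {e1 e2}.
Qed.

(** * Matrices that map cones of one fan to cones of another *)

Section FanIso.
Variables (R : realType) (n : nat).
Hypothesis n_gt0 : (0 < n)%N.

Lemma fan_cone (T : {set edge n}) Q : valid T Q -> triangulation_fan R T (@cone R _ Q).
Proof. by case=> h1 h2; exists Q. Qed.

Lemma fanP (T : {set edge n}) s : triangulation_fan R T s -> exists2 Q, valid T Q & s = @cone R _ Q.
Proof. by case=> Q [h1 h2 ->]; exists Q. Qed.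

Lemma valid1 (T : {set edge n}) k b : is_triangulation T -> inner k -> valid T [:: gen T k b].
Proof.
move=> hT ik; split=> [q|j ij].
  by rewrite inE => /eqP ->; exists k => //; case: b; [left|right].
rewrite !inE -/(gen T j true) -/(gen T j false) => -[/eqP /gen_inj e1 /eqP /gen_inj e2].
have [_ b1] := e1 n_gt0 hT ij ik; have [_ b2] := e2 n_gt0 hT ij ik.
by rewrite -b1 in b2.
Qed.

(** Otherwise [separation] yields a functional positive on this generator and nonpositive on the
    cone. *)
Lemma gen_in_cone (T : {set edge n}) Q k b : is_triangulation T -> valid T Q -> inner k ->
  @cone R _ Q (toR R (gen T k b)) -> gen T k b \in Q.
Proof.
move=> hT vQ ik hc; apply: contraT => nQ.
have [m [_ h2 h3]] := separation n_gt0 hT (valid1 b hT ik) vQ.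
have := h3 (gen T k b); rewrite inE eqxx nQ => /(_ isT isT).
have := @pairing_cone R _ (- m) Q _ _ hc; rewrite pairingNl pairing_toR -rmorphN ler0z.
rewrite oppr_ge0 => h; rewrite ltNge h // => q /h2.
by rewrite dotNl oppr_ge0.
Qed.

(** The last equation makes [c] a natural number, and the one before makes it a divisor of 1. *)
Lemma intr_scale_eq1 (c : R) (x y z w : int) : 0 <= c -> `|x| = 1 -> `|w| = 1 ->
  x%:~R = c * y%:~R -> z%:~R = c * w%:~R -> c = 1.
Proof.
move=> c0 hx hw exy ezw.
have ez : c = `|z|%:~R.
  by rewrite intr_norm ezw normrM -intr_norm hw mulr1 (ger0_norm c0).
have e1 : (`|z| * `|y|)%:~R = 1%:~R :> R.
  by rewrite -hx rmorphM /= -ez !intr_norm exy normrM (ger0_norm c0).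
have {}e1 := intr_inj e1.
have z1 : `|z| = 1.
  move: e1 (normr_ge0 z) (normr_ge0 y); case: `|z| `|y| => [a|a] [b|b] //.
  by rewrite -PoszM => -[/eqP]; rewrite muln_eq1 => /andP[/eqP->].
by rewrite ez z1.
Qed.

Variables (T T' : {set edge n}).
Hypotheses (hT : is_triangulation T) (hT' : is_triangulation T').

(** The image of a ray is a nonzero cone, so it contains a generator [q'], which is a multiple of
    [q *m A]. Entries of absolute value 1, in [q'] and in [q], force the factor to be 1. *)
Lemma fan_map_gen A : A \in unitmx ->
  (forall s, triangulation_fan R T s -> triangulation_fan R T' (img A s)) ->
  forall k b, inner k -> exists k' b', inner k' /\ gen T k b *m A = gen T' k' b'.
Proof.
move=> uA hA k b ik; set q := gen T k b.
have [Q' vQ' eQ] := fanP (hA _ (fan_cone (valid1 b hT ik))).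
have [j hj] := gen_neq0 n_gt0 hT b ik.
case eQ' : Q' => [|q' Q''].
  have : img A (@cone R _ [:: q]) (toR R q *m map_mx intr A).
    by exists (toR R q) => //; apply: mem_cone; rewrite inE.
  rewrite eQ eQ' cone_nil /= -map_mxM => h.
  have {}h : q *m A = 0 by apply: (@toR_inj R); rewrite /toR h map_mx0.
  have q0 : q = 0 by rewrite -(mulmxK uA q) h mul0mx.
  by move: hj; rewrite -/q q0 mxE normr0 => /esym/eqP; rewrite oner_eq0.
have q'Q : q' \in Q' by rewrite eQ' inE eqxx.
have [k' ik' e'] := vQ'.1 _ q'Q.
have [b' eb'] : exists b', q' = gen T' k' b' by case: e' => ->; [exists true|exists false].
exists k', b'; split=> //; rewrite -eb'.
have [i hi] := gen_neq0 n_gt0 hT' b' ik'; rewrite -eb' in hi.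
have : @cone R _ Q' (toR R q') by apply: mem_cone.
rewrite -eQ => -[y [c [c0 ->]]]; rewrite big_seq1 -scalemxAl -map_mxM => ec.
have ec2 : c q *: toR R q = toR R (q' *m invmx A).
  by rewrite [RHS]/toR map_mxM -/(toR R q') -ec -scalemxAl -map_mxM mulmxK.
have c1 : c q = 1.
  apply: (@intr_scale_eq1 _ (q' 0 i) ((q *m A) 0 i) ((q' *m invmx A) 0 j) (q 0 j)) => //.
    exact: scale_toR_entry ec.
  exact: scale_toR_entry ec2.
by apply: (@toR_inj R); rewrite -ec c1 scale1r.
Qed.

(** Two generators that are not siblings span a cone of the fan. Its image is a cone of the other
    fan containing both images, which then cannot be siblings. *)
Lemma fan_map_sib A : A \in unitmx ->
  (forall s, triangulation_fan R T s -> triangulation_fan R T' (img A s)) ->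
  forall k b j c, inner k -> inner j ->
  sibling T' (gen T k b *m A) (gen T j c *m A) -> sibling T (gen T k b) (gen T j c).
Proof.
move=> uA hA k b j c ik ij hs; apply: contrapT => ns.
set Q := [:: gen T k b; gen T j c].
have vQ : valid T Q.
  split=> [q|i ii].
    rewrite !inE => /orP[]/eqP->; [exists k => //|exists j => //].
      by case: b {hs ns Q}; [left|right].
    by case: c {hs ns Q}; [left|right].
  rewrite !inE -/(gen T i true) -/(gen T i false) => -[/orP[]/eqP e1 /orP[]/eqP e2].
  - by rewrite -e2 in e1; have [] := gen_inj n_gt0 hT ii ii e1.
  - by apply: ns; rewrite -e1 -e2; exists i, true.
  - by apply: ns; rewrite -e1 -e2; exists i, false.
  - by rewrite -e2 in e1; have [] := gen_inj n_gt0 hT ii ii e1.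
have [Q' vQ' eQ] := fanP (hA _ (fan_cone vQ)).
have hin q : q \in Q -> @cone R _ Q' (toR R (q *m A)).
  by rewrite -eQ => qQ; exists (toR R q); rewrite /toR ?map_mxM //; apply: mem_cone.
have [i [e [ii e1 e2]]] := hs.
have := hin (gen T k b); have := hin (gen T j c); rewrite !inE !eqxx ?orbT e1 e2.
move=> /(_ isT) /(gen_in_cone hT' vQ' ii) h1 /(_ isT) /(gen_in_cone hT' vQ' ii) h2.
by apply: (vQ'.2 i ii); case: e {e1 e2 hs} h1 h2.
Qed.

End FanIso.

Section FanIsoSib.
Variables (R : realType) (n : nat) (T T' : {set edge n}).
Hypotheses (n_gt0 : (0 < n)%N) (hT : is_triangulation T) (hT' : is_triangulation T').

Lemma fan_iso_sib_iso :
  fan_iso (triangulation_fan R T) (triangulation_fan R T') -> sib_iso T T'.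
Proof.
case=> A uA [hf _ hs]; exists A => //.
have hA s : triangulation_fan R T s -> triangulation_fan R T' (img A s) by apply: hf.
have uA' : invmx A \in unitmx by rewrite unitmx_inv.
have hA' s : triangulation_fan R T' s -> triangulation_fan R T (img (invmx A) s).
  by move=> /hs[s0 h0 <-]; rewrite -/(img A s0) imgK.
have g := fan_map_gen n_gt0 hT hT' uA hA; have g' := fan_map_gen n_gt0 hT' hT uA' hA'.
move=> q1 q2; split.
  case=> k [b [ik e1 e2]].
  have [k1 [b1 [ik1 f1]]] := g k b ik; have [k2 [b2 [ik2 f2]]] := g k (~~ b) ik.
  rewrite e1 e2 f1 f2; apply: (fan_map_sib n_gt0 hT' hT uA' hA') => //.
  by rewrite -f1 -f2 !mulmxK //; exists k, b.
case=> k [b [ik e1 e2]].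
have [k1 [b1 [ik1 f1]]] := g' k b ik; have [k2 [b2 [ik2 f2]]] := g' k (~~ b) ik.
have {}f1 : q1 = gen T k1 b1 by rewrite -f1 -e1 mulmxK.
have {}f2 : q2 = gen T k2 b2 by rewrite -f2 -e2 mulmxK.
rewrite f1 f2; apply: (fan_map_sib n_gt0 hT hT' uA hA) => //.
by rewrite -f1 -f2; exists k, b.
Qed.

Lemma sib_iso_fan_iso :
  sib_iso T T' -> fan_iso (triangulation_fan R T) (triangulation_fan R T').
Proof.
case=> A uA hA; exists A => //; split.
- move=> s /fanP[Q vQ ->]; rewrite -/(img A _) img_cone //.
  exact/fan_cone/(map_validP hA).
- by move=> s t _ _ e; rewrite -(imgK s uA) -(imgK t uA) /img e.
- move=> s /fanP[Q vQ ->]; have uA' : invmx A \in unitmx by rewrite unitmx_inv.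
  exists (img (invmx A) (@cone R _ Q)); last exact: imgKV.
  by rewrite img_cone //; apply/fan_cone/(map_validP (sib_mxV uA hA)).
Qed.

End FanIsoSib.

(** * Toric isomorphisms *)

Section SamePoint.
Variables (R : realType) (d : nat) (Sg : set (set 'rV[R]_d)).
Implicit Types x y : chart_point Sg.

Lemma same_pt_val x y : chart x = chart y ->
  (forall m, dual_monoid (chart x) m -> pt_val x m = pt_val y m) -> same_point x y.
Proof.
move=> exy hxy; exists (pt_val x); split=> //; last by rewrite -exy => m /hxy.
by rewrite -exy setIid; apply: val_hom.
Qed.

Lemma same_refl x : same_point x x.
Proof. exact: same_pt_val. Qed.

Lemma same_sym x y : same_point x y -> same_point y x.
Proof. by case=> delta [h1 h2 h3]; exists delta; split=> //; rewrite setIC. Qed.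

End SamePoint.

(** * Toric morphisms induced by lattice isomorphisms *)

Section Push.
Variables (R : realType) (d : nat) (Sg Sg' : set (set 'rV[R]_d)) (A : 'M[int]_d).
Hypotheses (uA : A \in unitmx) (hA : forall s, Sg s -> Sg' (img A s)).

Lemma pairingE m (x : 'rV[R]_d) : pairing m x = (x *m (toR R m)^T) 0 0.
Proof. by rewrite mxE; apply: eq_bigr => i _; rewrite !mxE mulrC. Qed.

Lemma dual_img (s : set 'rV[R]_d) m : dual_monoid (img A s) m <-> dual_monoid s (m *m A^T).
Proof.
have e (x : 'rV[R]_d) : pairing m (x *m map_mx intr A) = pairing (m *m A^T) x.
  by rewrite !pairingE /toR map_mxM trmx_mul -map_trmx trmxK mulmxA.
split=> h x; first by move=> sx; rewrite -e; apply: h; exists x.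
by case=> y sy <-; rewrite e; apply: h.
Qed.

Lemma imgI (s t : set 'rV[R]_d) : img A (s `&` t)%classic = (img A s `&` img A t)%classic.
Proof.
apply/seteqP; split=> [x [y [sy ty] <-]|x [[y sy <-] [z tz e]]].
  by split; exists y.
suff ezy : z = y by rewrite ezy in tz; exists y.
have uAR : map_mx intr A \in @unitmx R d.
  have := uA; rewrite !unitmxE det_map_mx => h; exact: rmorph_unit.
by rewrite -(mulmxK uAR z) e mulmxK.
Qed.

Lemma push_hom (s : set 'rV[R]_d) (gamma : 'rV[int]_d -> R[i]) : monoid_hom (dual_monoid s) gamma ->
  monoid_hom (dual_monoid (img A s)) (fun m => gamma (m *m A^T)).
Proof.
case=> g0 gD; split=> [|m m' /dual_img hm /dual_img hm']; first by rewrite mul0mx.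
by rewrite mulmxDl gD.
Qed.

Definition push (x : chart_point Sg) : chart_point Sg' :=
  ChartPoint (hA (chart_in x)) (push_hom (val_hom x)).

Lemma push_same x y : same_point x y -> same_point (push x) (push y).
Proof.
case=> delta [h1 h2 h3]; exists (fun m => delta (m *m A^T)); split.
- by rewrite -imgI; apply: push_hom.
- by move=> m /dual_img/h2.
- by move=> m /dual_img/h3.
Qed.

Lemma img_set0 : img A [set 0 : 'rV[R]_d]%classic = [set 0]%classic.
Proof.
apply/seteqP; split=> x; first by case=> _ -> <-; rewrite mul0mx.
by move=> ->; exists 0; rewrite ?mul0mx.
Qed.

Lemma push_toric : toric_morphism push.
Proof.
split; first split; first exact: push_same.
(* With [g] the constant 1 the neighbourhood is the whole chart, and the pullback of the character
   [m] is the character [m *m A^T]. *)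
- move=> x; exists [:: (1, 0)]; split.
  + by move=> t; rewrite inE => /eqP -> u _; rewrite /pairing big1 // => i _; rewrite mxE mul0r.
  + by rewrite /ev big_seq1 mul1r (val_hom x).1 oner_neq0.
  move=> m hm; exists [:: (1, m *m A^T)], 0%N.
    by move=> t; rewrite inE => /eqP ->; apply/dual_img.
  move=> y ey _; exists (push y); split; [exact: same_refl | by rewrite /= ey |].
  by rewrite /ev big_seq1 mul1r expr0 divr1.
- by move=> x [y yx cy]; exists (push y); [apply: push_same | rewrite /= cy img_set0].
- move=> x y z [x' [y' [z' [[xx yy zz] [cx cy cz] h]]]].
  exists (push x'), (push y'), (push z'); split.
  + by split; apply: push_same.
  + by rewrite /= cx cy cz img_set0.
  + by move=> m; apply: h.
Qed.

End Push.

Lemma pushK (R : realType) d (Sg Sg' : set (set 'rV[R]_d)) (A B : 'M[int]_d)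
  (hA : forall s, Sg s -> Sg' (img A s)) (hB : forall s, Sg' s -> Sg (img B s)) x :
  A *m B = 1%:M -> same_point (push hB (push hA x)) x.
Proof.
move=> AB; have BA : B^T *m A^T = 1%:M by rewrite -trmx_mul AB trmx1.
apply: same_pt_val => [|m _] /=; first by rewrite img_mul AB img1.
by rewrite -mulmxA BA mulmx1.
Qed.

Lemma fan_iso_toric_iso (R : realType) d (Sg Sg' : set (set 'rV[R]_d)) :
  fan_iso Sg Sg' -> toric_iso Sg Sg'.
Proof.
case=> A uA [hf _ hs].
have hA s : Sg s -> Sg' (img A s) by apply: hf.
have uB : invmx A \in unitmx by rewrite unitmx_inv.
have hB s : Sg' s -> Sg (img (invmx A) s) by move=> /hs[t ht <-]; rewrite -/(img A t) imgK.
exists (push hA), (push hB); split.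
- exact: push_toric.
- exact: push_toric.
- by move=> x; apply: pushK; rewrite mulmxV.
- by move=> y; apply: pushK; rewrite mulVmx.
Qed.

(** * Multiplicative rational functions of one variable *)

Section Characters.
Variable F : numFieldType.

Lemma poly_eq0_horner (p : {poly F}) : (forall s, p.[s] = 0) -> p = 0.
Proof.
move=> h; apply/eqP; apply: contraT => p0.
have := @max_poly_roots _ p [seq i%:R | i <- iota 0 (size p)] p0.
rewrite size_map size_iota ltnn; apply.
  by apply/allP => x _; rewrite /root h.
by rewrite map_inj_uniq ?iota_uniq // => i j /eqP; rewrite eqr_nat => /eqP.
Qed.

Lemma two_exprz_inj (a b : int) : (2%:R : F) ^ a = 2%:R ^ b -> a = b.
Proof.
have two0 : (2%:R : F) != 0 by rewrite pnatr_eq0.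
have key (c : nat) (x : int) : (2%:R : F) ^ (x + c.+1) = 2%:R ^ x -> False.
  rewrite expfzDr // -[RHS]mulr1 => /(mulfI (expfz_neq0 x two0)).
  move/eqP; rewrite -exprnP -natrX pnatr_eq1.
  by have := @leq_pexp2l 2 1 c.+1 isT isT; case: (2 ^ c.+1)%N => [|[]].
move=> e; apply/eqP; apply: contraT => ne; exfalso.
have [lt|le] := ltrP a b.
  apply: (key (absz (b - a)).-1 a); rewrite e; congr (_ ^ _); lia.
apply: (key (absz (a - b)).-1 b); rewrite -e; congr (_ ^ _); lia.
Qed.

(* Comparing leading coefficients in K(rX) H(X) = chi(r) K(X) H(rX). *)
Lemma rational_character (chi : F -> F) (H K : {poly F}) :
  (forall s t, s != 0 -> t != 0 -> chi (s * t) = chi s * chi t) ->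
  (forall s, s != 0 -> chi s != 0) -> H != 0 ->
  (forall s, s != 0 -> H.[s] != 0 -> chi s * H.[s] = K.[s]) ->
  exists k : int, forall s, s != 0 -> chi s = s ^ k.
Proof.
move=> chiM chi0 H0 hK.
have K0 : K != 0.
  apply/eqP => K0; have : 'X * H = 0.
    apply: poly_eq0_horner => s; rewrite hornerM hornerX.
    have [->|s0] := eqVneq s 0; first by rewrite mul0r.
    have [->|Hs] := eqVneq H.[s] 0; first by rewrite mulr0.
    have := hK s s0 Hs; rewrite K0 horner0 => /eqP.
    by rewrite mulf_eq0 (negPf (chi0 s s0)) (negPf Hs).
  by move/eqP; rewrite mulf_eq0 polyX_eq0 (negPf H0).
exists ((size K).-1%:Z - (size H).-1%:Z) => r r0.
pose q := r *: ('X : {poly F}).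
have qs (p : {poly F}) s : (p \Po q).[s] = p.[r * s].
  by rewrite horner_comp /q hornerZ hornerX.
have lq (p : {poly F}) : lead_coef (p \Po q) = lead_coef p * r ^+ (size p).-1.
  by rewrite lead_coef_comp ?lead_coefZ ?lead_coefX ?mulr1 // size_scale // size_polyX.
have id : (K \Po q) * H = chi r *: (K * (H \Po q)).
  have Hq0 : H \Po q != 0.
    by rewrite -lead_coef_eq0 lq mulf_neq0 ?expf_neq0 // lead_coef_eq0.
  have nz : 'X * H * (H \Po q) != 0 by rewrite !mulf_neq0 // polyX_eq0.
  apply/eqP; rewrite -subr_eq0 -(inj_eq (mulfI nz)) mulr0; apply/eqP.
  apply: poly_eq0_horner => s.
  rewrite !(hornerM, hornerD, hornerN, hornerZ, hornerX) !qs.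
  have [->|s0] := eqVneq s 0; first by rewrite !mul0r.
  have [->|Hs] := eqVneq H.[s] 0; first by rewrite mulr0 !mul0r.
  have [->|Hrs] := eqVneq H.[r * s] 0; first by rewrite mulr0 mul0r.
  have rs0 : r * s != 0 by rewrite mulf_neq0.
  by rewrite -(hK _ s0 Hs) -(hK _ rs0 Hrs) chiM //; ring.
move/(congr1 lead_coef): id; rewrite lead_coefZ !lead_coefM !lq => id.
have lK : lead_coef K != 0 by rewrite lead_coef_eq0.
have lH : lead_coef H != 0 by rewrite lead_coef_eq0.
rewrite expfzDr // -exprnP -invr_expz -exprnP.
have rH : r ^+ (size H).-1 != 0 by rewrite expf_neq0.
apply: (mulIf rH); rewrite -mulrA mulVf // mulr1.
apply: (mulfI lK); apply: (mulfI lH).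
have -> : lead_coef H * (lead_coef K * (chi r * r ^+ (size H).-1)) =
  chi r * (lead_coef K * (lead_coef H * r ^+ (size H).-1)) by ring.
by rewrite -id; ring.
Qed.

End Characters.

Lemma additive_intE d (phi : 'rV[int]_d -> int) :
  (forall x y, phi (x + y) = phi x + phi y) ->
  forall x, phi x = \sum_i x 0 i * phi (delta_mx 0 i).
Proof.
move=> phiD.
have phi0 : phi 0 = 0 by apply: (addrI (phi 0)); rewrite -phiD !addr0.
have phiN x : phi (- x) = - phi x.
  by apply: (addrI (phi x)); rewrite -phiD !subrr.
have phin (k : nat) x : phi (x *+ k) = phi x *+ k.
  by elim: k => [|k IHk]; rewrite ?mulr0n // !mulrS phiD IHk.
have phiZ c x : phi (c *: x) = c * phi x.
  case: c => k; first by rewrite -[Posz k]natz scaler_nat phin mulr_natl.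
  by rewrite NegzE scaleNr phiN -[Posz _]natz scaler_nat phin mulNr mulr_natl.
move=> x; rewrite {1}[x]row_sum_delta (big_morph phi phiD phi0).
by apply: eq_bigr => i _; rewrite phiZ.
Qed.

Section LaurentEval.
Variables (F : numFieldType) (d : nat).

Lemma laurent_poly (p : seq (F * 'rV[int]_d)) u : exists N (P : {poly F}),
  forall s, s != 0 -> s ^+ N * (\sum_(t <- p) t.1 * s ^ dot t.2 u) = P.[s].
Proof.
elim: p => [|t p [N [P hP]]].
  by exists 0%N, 0 => s s0; rewrite big_nil mulr0 horner0.
exists (N + absz (dot t.2 u))%N, ('X^(absz (dot t.2 u)) * P
  + t.1 *: 'X^(absz (N%:Z + `|dot t.2 u| + dot t.2 u))) => s s0.
rewrite big_cons !(hornerD, hornerM, hornerZ, hornerXn) -hP //.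
set z := dot t.2 u.
have -> : s ^+ absz (N%:Z + `|z| + z) = s ^+ (N + absz z) * s ^ z.
  rewrite [LHS]exprnP [s ^+ (N + _)]exprnP -expfzDr //; congr (_ ^ _); lia.
by rewrite exprD; ring.
Qed.

Lemma nonneg_poly (p : seq (F * 'rV[int]_d)) u :
  (forall t, t \in p -> 0 <= dot t.2 u) -> exists P : {poly F},
  forall s, \sum_(t <- p) t.1 * s ^ dot t.2 u = P.[s].
Proof.
move=> hp; exists (\sum_(t <- p) t.1 *: 'X^(absz (dot t.2 u))) => s.
rewrite horner_sum !big_seq; apply: eq_bigr => t /hp h.
by rewrite hornerZ hornerXn exprnP abszE ger0_norm.
Qed.

End LaurentEval.

(** * Points of the torus as characters of the dual lattice *)

Section Torus.
Variables (R : realType) (d : nat) (Sg : set (set 'rV[R]_d)).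
Implicit Types w x y z : chart_point Sg.

Lemma dual_set0 (m : 'rV[int]_d) : dual_monoid [set 0 : 'rV[R]_d]%classic m.
Proof. by move=> u ->; rewrite pairing0r. Qed.

Lemma torus_valD w : chart w = [set 0]%classic ->
  forall m m', pt_val w (m + m') = pt_val w m * pt_val w m'.
Proof.
by move=> cw m m'; apply: (val_hom w).2; rewrite cw; apply: dual_set0.
Qed.

Lemma torus_val_neq0 w : chart w = [set 0]%classic -> forall m, pt_val w m != 0.
Proof.
move=> cw m; apply/eqP => e; have := torus_valD cw m (- m).
by rewrite subrr (val_hom w).1 e mul0r => /eqP; rewrite oner_eq0.
Qed.

Lemma same_torusP w z : chart w = [set 0]%classic ->
  same_point w z <-> forall m, dual_monoid (chart z) m -> pt_val w m = pt_val z m.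
Proof.
move=> cw; split=> [[delta [_ h1 h2]] m hm|h].
  by rewrite -h2 // -h1 // cw; apply: dual_set0.
exists (pt_val w); split=> //; split; first exact: (val_hom w).1.
by move=> *; apply: torus_valD.
Qed.

End Torus.

(** * Separatedness along the torus, and one-parameter subgroups with their limits *)

Section FanVariety.
Variables (R : realType) (n : nat) (T : {set edge n}).
Hypotheses (n_gt0 : (0 < n)%N) (hT : is_triangulation T).
Local Notation Sg := (triangulation_fan R T).
Implicit Types w x y z : chart_point Sg.

(* Some multiple of the separating functional, added to a character regular on
   the chart of z, makes it regular on the chart of p. *)
Lemma same_torus_trans w p z : chart w = [set 0]%classic ->
  same_point w p -> same_point p z -> same_point w z.
Proof.
move=> cw /(same_torusP _ cw) wp [delta [[_ deltaD] hp hz]]; apply/(same_torusP _ cw) => m hm.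
have [Qp vQp ep] := fanP (chart_in p); have [Qz vQz ez] := fanP (chart_in z).
have [m0 [m0ge _ m0gt]] := separation n_gt0 hT vQp vQz.
(* [N] bounds every [|dot m q|]. On generators outside [Qz] the functional [m0] is at least 1, and
   on the others [m] itself is nonnegative. *)
pose N : int := \sum_(q <- Qp) `|dot m q|.
have N0 : 0 <= N by apply: sumr_ge0.
have /dual_coneP hmz : dual_monoid (@cone R _ Qz) m by rewrite -ez.
have hNm : dual_monoid (chart p) (N *: m0).
  by rewrite ep; apply/dual_coneP => q qQ; rewrite dotZl mulr_ge0 // m0ge.
have hmN : dual_monoid (chart p) (m + N *: m0).
  rewrite ep; apply/dual_coneP => q qQ; rewrite dotDl dotZl.
  case qz: (q \in Qz).
    by rewrite addr_ge0 ?mulr_ge0 ?m0ge // hmz.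
  have h0 := m0gt q qQ (negbT qz).
  have hN : `|dot m q| <= N.
    by rewrite /N (big_rem q) //= lerDl sumr_ge0.
  have : N <= N * dot m0 q by rewrite ler_peMr //; lia.
  by move: hN; have := ler_norm (- dot m q); rewrite normrN; lia.
have hmI : dual_monoid (chart p `&` chart z)%classic m by move=> u [_ su]; apply: hm.
have hNI : dual_monoid (chart p `&` chart z)%classic (N *: m0).
  by move=> u [su _]; apply: hNm.
have e := deltaD m (N *: m0) hmI hNI.
rewrite (hp _ hmN) (hp _ hNm) -(wp _ hmN) -(wp _ hNm) torus_valD // in e.
by rewrite -hz //; apply: (mulIf (torus_val_neq0 cw (N *: m0))); rewrite e.
Qed.

Lemma torus_uniq w1 w2 p : chart w1 = [set 0]%classic -> chart w2 = [set 0]%classic ->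
  same_point w1 p -> same_point w2 p -> pt_val w1 = pt_val w2.
Proof.
move=> c1 c2 h1 /same_sym h2; apply/funext => m.
have /(same_torusP _ c1) := same_torus_trans c1 h1 h2.
by apply; rewrite c2; apply: dual_set0.
Qed.

(* The value at s of the one-parameter subgroup of u, as a point of the chart of Q;
   for s = 0 it is its limit. *)
Definition is_lam (y : chart_point Sg) (Q : seq 'rV[int]_n) (u : 'rV[int]_n) (s : R[i]) : Prop :=
  chart y = cone Q /\ pt_val y = fun m => s ^ dot m u.

(** For [s = 0] the map is still multiplicative when all exponents from the dual monoid are
    nonnegative, since 0 to the power 0 is 1. *)
Lemma ex_lam Q u s : valid T Q ->
  s != 0 \/ (forall m, (forall q, q \in Q -> 0 <= dot m q) -> 0 <= dot m u) ->
  exists y, is_lam y Q u s.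
Proof.
move=> vQ h.
have hh : monoid_hom (dual_monoid (@cone R _ Q)) (fun m => s ^ dot m u).
  split; first by rewrite dot0l expr0z.
  move=> m m' /dual_coneP hm /dual_coneP hm'; rewrite dotDl.
  by case: h => [s0|h]; [rewrite expfzDr | rewrite exprzD_ss // !h].
by exists (ChartPoint (fan_cone R vQ) hh).
Qed.

Lemma valid_nil : valid T [::].
Proof. by split=> // k _ [] //. Qed.

Lemma ex_tp u s : s != 0 -> exists y, is_lam y [::] u s.
Proof. by move=> s0; apply: ex_lam; [apply: valid_nil|left]. Qed.

Lemma tp_chart y u s : is_lam y [::] u s -> chart y = [set 0]%classic.
Proof. by case=> -> _; rewrite cone_nil. Qed.

Lemma lam_same y z Q u s : s != 0 -> is_lam y [::] u s -> is_lam z Q u s -> same_point y z.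
Proof.
move=> s0 hy [cz ez]; apply/(same_torusP _ (tp_chart hy)) => m _.
by case: hy => _ ->; rewrite ez.
Qed.

Lemma ev_lam p y Q u s : is_lam y Q u s -> ev p y = \sum_(t <- p) t.1 * s ^ dot t.2 u.
Proof. by case=> _ e; rewrite /ev e. Qed.

(** The dual monoid of a cone generates the whole lattice as a group: add to [m] a large multiple of
    a functional positive on all of [Q], obtained by separating [Q] from the zero cone. *)
Lemma dual_generate Q m : valid T Q ->
  exists m0, (forall q, q \in Q -> 0 <= dot m0 q) /\ (forall q, q \in Q -> 0 <= dot (m + m0) q).
Proof.
move=> vQ; have [m0 [_ _ h]] := separation n_gt0 hT vQ valid_nil.
pose N : int := \sum_(q <- Q) `|dot m q|.
have N0 : 0 <= N by apply: sumr_ge0.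
exists (N *: m0); split=> q qQ; have h0 := h q qQ isT.
  by rewrite dotZl mulr_ge0 // ltW.
rewrite dotDl dotZl; have hN : `|dot m q| <= N by rewrite /N (big_rem q) //= lerDl sumr_ge0.
have : N <= N * dot m0 q by rewrite ler_peMr //; lia.
by move: hN; have := ler_norm (- dot m q); rewrite normrN; lia.
Qed.

End FanVariety.

(** Dual form of the statement that [A] maps each maximal cone into a maximal cone. *)
Definition cone_to_cone n (T T' : {set edge n}) (A : 'M[int]_n) : Prop :=
  forall b, exists b', forall m,
    (forall k, inner k -> 0 <= dot m (gen T' k (b' k))) ->
    forall k, inner k -> 0 <= dot m (gen T k (b k) *m A).

(** * The integer matrix of a toric morphism and its effect on maximal cones *)

Section ToricMorphism.
Variables (R : realType) (n : nat) (T T' : {set edge n}).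
Hypotheses (n_gt0 : (0 < n)%N) (hT : is_triangulation T) (hT' : is_triangulation T').
Local Notation Sg := (triangulation_fan R T).
Local Notation Sg' := (triangulation_fan R T').
Variable f : chart_point Sg -> chart_point Sg'.
Hypothesis hf : toric_morphism f.

Definition induces (A : 'M[int]_n) : Prop := forall u s y, s != 0 -> is_lam y [::] u s ->
  exists2 w, is_lam w [::] (u *m A) s & same_point w (f y).

(** Let [chi (u, s)] be the character of the image of the point [s] of the one-parameter subgroup of
    [u]. It is multiplicative in [s] and rational in [s], hence a power of [s], and the exponent is
    biadditive in [u] and [m]. *)
Lemma toric_morphism_mx : exists A, induces A.
Proof.
case: hf => [[fsame fmor] ftorus fmul].
have /choice[chi hchi] : forall us : 'rV[int]_n * R[i], exists c : 'rV[int]_n -> R[i],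
    us.2 != 0 -> exists y w, [/\ is_lam y [::] us.1 us.2, chart w = [set 0]%classic,
      same_point w (f y) & pt_val w = c].
  move=> [u s] /=; case: (eqVneq s 0) => [->|s0]; first by exists (fun=> 0).
  have [y hy] := @ex_tp R n T u s s0.
  have [|w wy cw] := ftorus y; first by exists y; [apply: same_refl | apply: tp_chart hy].
  by exists (pt_val w) => _; exists y, w.
have chiP u s y w : s != 0 -> is_lam y [::] u s -> chart w = [set 0]%classic ->
    same_point w (f y) -> pt_val w = chi (u, s).
  move=> s0 hy cw wy; have [y0 [w0 [hy0 cw0 w0y0 <-]]] := hchi (u, s) s0.
  apply: (torus_uniq n_gt0 hT' cw cw0 wy).
  by apply: (same_torus_trans n_gt0 hT' cw0 w0y0); apply/fsame/(lam_same s0 hy0 hy).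
have chi_neq0 u s m : s != 0 -> chi (u, s) m != 0.
  move=> s0; have [y [w [_ cw _ <-]]] := hchi (u, s) s0.
  exact: torus_val_neq0.
have chi_charD u s m m' : s != 0 -> chi (u, s) (m + m') = chi (u, s) m * chi (u, s) m'.
  move=> s0; have [y [w [_ cw _ <-]]] := hchi (u, s) s0.
  exact: torus_valD.
have chi_mul u1 s1 u2 s2 u3 s3 : s1 != 0 -> s2 != 0 -> s3 != 0 ->
    (forall m, s3 ^ dot m u3 = s1 ^ dot m u1 * s2 ^ dot m u2) ->
    forall m, chi (u3, s3) m = chi (u1, s1) m * chi (u2, s2) m.
  move=> s10 s20 s30 e m.
  have [y1 h1] := @ex_tp R n T u1 s1 s10; have [y2 h2] := @ex_tp R n T u2 s2 s20.
  have [y3 h3] := @ex_tp R n T u3 s3 s30.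
  have [|x' [y' [z' [[xx yy zz] [cx cy cz] h]]]] := fmul y1 y2 y3.
    exists y1, y2, y3; split; first by split; apply: same_refl.
      by rewrite !(tp_chart h1, tp_chart h2, tp_chart h3).
    by case: h1 h2 h3 => _ -> [_ ->] [_ ->] m'; apply: e.
  by rewrite -(chiP _ _ _ _ s10 h1 cx xx) -(chiP _ _ _ _ s20 h2 cy yy)
     -(chiP _ _ _ _ s30 h3 cz zz).
have one0 : (1 : R[i]) != 0 by apply: oner_neq0.
(* The identity of the torus lies on every one-parameter subgroup, so regularity of [f] there serves
   all [u] at once. *)
have [x0 hx0] := @ex_tp R n T 0 1 one0.
have [g [_ gx0 hg]] := fmor x0.
have [Q vQ eQ] := fanP (chart_in (f x0)).
have chi_rat u m : dual_monoid (chart (f x0)) m ->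
    exists k : int, forall s, s != 0 -> chi (u, s) m = s ^ k.
  move=> hmd; have [a [e _ ha]] := hg m hmd.
  have [N [G hG]] := laurent_poly g u; have [M [P hP]] := laurent_poly a u.
  have G0 : G != 0.
    apply/eqP => G0; have [y hy] := @ex_tp R n T u 1 one0.
    have := hG 1 one0; rewrite G0 horner0 expr1n mul1r -(ev_lam _ hy) => /eqP.
    suff -> : ev g y = ev g x0 by rewrite (negPf gx0).
    by rewrite (ev_lam _ hy) (ev_lam _ hx0); apply: eq_bigr => t _; rewrite !exp1rz.
  (* Clearing denominators in [a / g ^+ e] with [g = G / s ^+ N] and [a = P / s ^+ M] gives the two
     polynomials. The extra factor [G] limits the condition to points where [g] does not vanish. *)
  apply: (@rational_character _ (fun s => chi (u, s) m) ('X^M * G ^+ e * G) ('X^(N * e) * P * G)).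
  - move=> s t s0 t0; apply: chi_mul; rewrite ?mulf_neq0 // => m'.
    by rewrite exprzMl // unitfE.
  - by move=> s s0; apply: chi_neq0.
  - by rewrite !mulf_neq0 ?expf_neq0 // polyX_eq0.
  move=> s s0; rewrite !(hornerM, hornerXn, horner_exp) => nz.
  have Gs0 : G.[s] != 0 by apply: contraNneq nz => ->; rewrite mulr0.
  have [y hy] := @ex_tp R n T u s s0.
  have gy : s ^+ N * ev g y = G.[s] by rewrite (ev_lam _ hy) hG.
  have ay : s ^+ M * ev a y = P.[s] by rewrite (ev_lam _ hy) hP.
  have gy0 : ev g y != 0 by apply: contraNneq Gs0 => e0; rewrite -gy e0 mulr0.
  have [|z [zy cz ez]] := ha y _ gy0.
    by rewrite (tp_chart hy) (tp_chart hx0).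
  have [y0 [w [hy0 cw wy0 ew]]] := hchi (u, s) s0.
  have wz : same_point w z.
    apply: (same_torus_trans n_gt0 hT' cw (p := f y)); last exact: same_sym.
    apply: (same_torus_trans n_gt0 hT' cw wy0).
    exact/fsame/(lam_same s0 hy0 hy).
  have -> : chi (u, s) m = ev a y / ev g y ^+ e.
    by rewrite -ew -ez; apply: ((same_torusP z cw).1 wz); rewrite cz.
  rewrite -gy -ay exprMn -exprM.
  have : ev g y ^+ e != 0 by rewrite expf_neq0.
  move: (ev g y ^+ e) (s ^+ (N * e)) (s ^+ M) (s ^+ N) (ev a y) (ev g y) => *.
  by field.
have chi_pow u m : exists k : int, forall s, s != 0 -> chi (u, s) m = s ^ k.
  have [m0 [h0 h1]] := dual_generate n_gt0 hT' m vQ.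
  have [|k0 e0] := chi_rat u m0; first by rewrite eQ; apply/dual_coneP.
  have [|k1 e1] := chi_rat u (m + m0); first by rewrite eQ; apply/dual_coneP.
  exists (k1 - k0) => s s0; have := chi_charD u s m m0 s0.
  rewrite e0 // e1 // expfzDr // -invr_expz => ->.
  by rewrite mulfK // expfz_neq0.
have /choice[k hk] : forall um : 'rV[int]_n * 'rV[int]_n, exists k : int,
    forall s, s != 0 -> chi (um.1, s) um.2 = s ^ k by move=> [u m]; apply: chi_pow.
(* The powers of 2 are distinct, so additivity of the exponents can be read off at [s = 2]. *)
have two0 : (2%:R : R[i]) != 0 by rewrite pnatr_eq0.
have kDr u m m' : k (u, m + m') = k (u, m) + k (u, m').
  apply: (@two_exprz_inj R[i]); rewrite expfzDr //.
  by rewrite -(hk (u, _)) // -(hk (u, m)) // -(hk (u, m')) //= chi_charD.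
have kDl u u' m : k (u + u', m) = k (u, m) + k (u', m).
  apply: (@two_exprz_inj R[i]); rewrite expfzDr //.
  rewrite -(hk (_, _)) // -(hk (u, m)) // -(hk (u', m)) //=.
  by apply: chi_mul => // m'; rewrite dotDr expfzDr.
pose A : 'M[int]_n := \matrix_(i, j) k (delta_mx 0 i, delta_mx 0 j).
have kA u m : k (u, m) = dot m (u *m A).
  rewrite (additive_intE (phi := fun u => k (u, m))) //.
  under eq_bigr => i _ do
    rewrite (additive_intE (phi := fun m => k (delta_mx 0 i, m))) // big_distrr.
  rewrite exchange_big; apply: eq_bigr => j _; rewrite /= mxE big_distrr.
  by apply: eq_bigr => i _; rewrite /= mxE mulrCA.
exists A => u s y s0 hy.
have [w hw] := @ex_tp R n T' (u *m A) s s0; exists w => //.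
have [y0 [w0 [hy0 cw0 wy0 ew0]]] := hchi (u, s) s0.
have cw := tp_chart hw.
apply: (same_torus_trans n_gt0 hT' cw (p := w0)).
  by apply: same_pt_val => [|m _]; rewrite ?cw // ew0 hw.2 (hk (u, m)) // kA.
by apply: (same_torus_trans n_gt0 hT' cw0 wy0); apply/fsame/(lam_same s0 hy0 hy).
Qed.

(** Every [u = u0 + M q0] is interior to the cone and has the same limit point [x] at [s = 0]. A
    character regular around [f x] has no pole along it, so [m] is nonnegative on [u *m A]; letting
    [M] grow gives the claim for [q0]. *)
Lemma induces_cone A : induces A -> cone_to_cone T T' A.
Proof.
move=> hA b; case: hf => [[fsame fmor] _ _].
have vB := basis_valid n_gt0 hT b.
pose u0 : 'rV[int]_n := \sum_(q <- basis T b) q.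
have u0_ge0 m : (forall q, q \in basis T b -> 0 <= dot m q) -> 0 <= dot m u0.
  by move=> h; rewrite dot_sumr big_seq; apply: sumr_ge0.
have [x hx] : exists x, @is_lam R n T x (basis T b) u0 0 by apply: ex_lam => //; right.
have [g [gdual gx hg]] := fmor x.
have [Q' vQ' eQ'] := fanP (chart_in (f x)).
(* This choice completes [Q'] to a maximal cone: where neither generator of a pair lies in [Q'], it
   takes [wvec]. *)
exists (fun k => gen T' k true \in Q') => m hm k ik.
have hmd : dual_monoid (chart (f x)) m.
  rewrite eQ'; apply/dual_coneP => q qQ; have [j ij e] := vQ'.1 q qQ.
  have := hm j ij; case hv: (gen T' j true \in Q') => h; case: e qQ => -> // qQ.
    by case: (vQ'.2 j ij).
  by rewrite hv in qQ.
have [a [e adual ha]] := hg m hmd.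
set q0 := gen T k (b k); have q0B : q0 \in basis T b by apply/mem_basis; exists k.
have claim (M : nat) : 0 <= dot m ((u0 + q0 *+ M) *m A).
  set u := u0 + q0 *+ M.
  have uE m' : dot m' u = dot m' u0 + dot m' q0 *+ M.
    by rewrite dotDr -scaler_nat dotZr mulr_natl.
  have u_ge0 m' : (forall q, q \in basis T b -> 0 <= dot m' q) -> 0 <= dot m' u.
    by move=> h; rewrite uE addr_ge0 ?u0_ge0 // mulrn_wge0 // h.
  have u_eq0 m' : (forall q, q \in basis T b -> 0 <= dot m' q) ->
      (dot m' u == 0) = (dot m' u0 == 0).
    move=> h; rewrite uE paddr_eq0 ?u0_ge0 ?mulrn_wge0 ?h //.
    case: eqP => //=; rewrite dot_sumr big_seq => /eqP.
    rewrite psumr_eq0 // => /allP/(_ _ q0B); rewrite q0B /= => /eqP ->.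
    by rewrite mul0rn eqxx.
  have lam s : exists y, @is_lam R n T y (basis T b) u s by apply: ex_lam => //; right.
  have cx : chart x = @cone R _ (basis T b) by case: hx.
  have gd t : t \in g -> forall q, q \in basis T b -> 0 <= dot t.2 q.
    by move=> /gdual; rewrite cx => /dual_coneP.
  have ad t : t \in a -> forall q, q \in basis T b -> 0 <= dot t.2 q.
    by move=> /adual; rewrite cx => /dual_coneP.
  have [G hG] := @nonneg_poly R[i] n g u (fun t tg => u_ge0 _ (gd t tg)).
  have [P hP] := @nonneg_poly R[i] n a u (fun t ta => u_ge0 _ (ad t ta)).
  have G0 : G.[0] != 0.
    rewrite -hG; have -> : \sum_(t <- g) t.1 * 0 ^ dot t.2 u = ev g x; last by [].
    rewrite (ev_lam _ hx) !big_seq; apply: eq_bigr => t tg.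
    by rewrite !exp0rz u_eq0 //; apply: gd.
  rewrite leNgt; apply/negP => neg; set j := dot m (u *m A) in neg.
  have Gn0 : G != 0 by apply: contraNneq G0 => ->; rewrite horner0.
  (* Off [s = 0] the value [s ^ j] of the character equals [P / G ^+ e]. With [j] negative this
     polynomial identity makes [G] vanish at 0, where it equals the nonzero value of [g] at [x]. *)
  have id : G ^+ e = 'X^(absz j) * P.
    have nz : 'X * G != 0 by rewrite mulf_neq0 // polyX_eq0.
    apply/eqP; rewrite -subr_eq0 -(inj_eq (mulfI nz)) mulr0; apply/eqP.
    apply: poly_eq0_horner => s.
    rewrite !(hornerM, hornerD, hornerN, hornerX, hornerXn, horner_exp).
    have [->|s0] := eqVneq s 0; first by rewrite !mul0r.
    have [->|Gs0] := eqVneq G.[s] 0; first by rewrite mulr0 mul0r.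
    have [y hy] := lam s; have [t ht] := @ex_tp R n T u s s0.
    have [w hw wt] := hA u s t s0 ht; have cw := tp_chart hw.
    have gy : ev g y = G.[s] by rewrite (ev_lam _ hy) hG.
    have [||z [zy cz ez]] := ha y; first by case: hy => ->.
      by rewrite gy.
    have wz : same_point w z.
      apply: (same_torus_trans n_gt0 hT' cw (p := f y)); last exact: same_sym.
      by apply: (same_torus_trans n_gt0 hT' cw wt); apply/fsame/(lam_same s0 ht hy).
    have := (same_torusP z cw).1 wz m; rewrite cz => /(_ hmd).
    rewrite hw.2 -/j ez gy (ev_lam _ hy) hP => ej.
    have ejj : s ^+ absz j * s ^ j = 1.
      by rewrite [s ^+ _]exprnP -expfzDr // abszE ltr0_norm // addNr expr0z.
    have Ge0 : G.[s] ^+ e != 0 by rewrite expf_neq0.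
    have -> : P.[s] = s ^ j * G.[s] ^+ e by rewrite ej divfK.
    by rewrite [s ^+ _ * _]mulrA ejj mul1r subrr mulr0.
  have /eqP := congr1 (fun p : {poly R[i]} => p.[0]) id.
  rewrite hornerM hornerXn horner_exp expr0n; have -> : (absz j == 0%N) = false by lia.
  by rewrite mul0r expf_eq0 (negPf G0) andbF.
rewrite leNgt; apply/negP => neg.
have := claim (absz (dot m (u0 *m A))).+1.
rewrite mulmxDl -scaler_nat -scalemxAl dotDr dotZr natz.
by move: (dot m (u0 *m A)) (dot m (q0 *m A)) neg => x1 x2; nia.
Qed.

End ToricMorphism.

Lemma induces_comp (R : realType) n (T T' : {set edge n})
    (f : chart_point (triangulation_fan R T) -> chart_point (triangulation_fan R T'))
    (g : chart_point (triangulation_fan R T') -> chart_point (triangulation_fan R T)) A B :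
  (0 < n)%N -> is_triangulation T -> toric_morphism g ->
  induces f A -> induces g B -> (forall x, same_point (g (f x)) x) -> A *m B = 1%:M.
Proof.
move=> n_gt0 hT [[gsame _] _ _] hA hB gf; apply/row_matrixP => i; rewrite row1 rowE.
set u := delta_mx 0 i; have two0 : (2%:R : R[i]) != 0 by rewrite pnatr_eq0.
have [t ht] := @ex_tp R n T u _ two0; have [w hw wft] := hA u _ t two0 ht.
have [w2 hw2 w2g] := hB _ _ w two0 hw; have c2 := tp_chart hw2.
have w2t : same_point w2 t.
  apply: (same_torus_trans n_gt0 hT c2 (p := g (f t))) => //.
  by apply: (same_torus_trans n_gt0 hT c2 w2g); apply: gsame.
apply/rowP => j; rewrite -[LHS]dotC_delta -[RHS]dotC_delta.
apply: (@two_exprz_inj R[i]); have := (same_torusP t c2).1 w2t (delta_mx 0 j).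
rewrite hw2.2 ht.2 mulmxA; apply.
by rewrite (tp_chart ht); apply: dual_set0.
Qed.

(** * Mutually inverse matrices that respect maximal cones *)

Section ConeToCone.
Variables (n : nat).
Hypothesis n_gt0 : (0 < n)%N.

(** The columns of the inverse basis matrix are the dual basis, which is nonnegative on the target
    cone; applied to the images they give the coordinates. *)
Lemma cone_to_cone_coord (T T' : {set edge n}) A b b' : is_triangulation T' ->
  (forall m, (forall k, inner k -> 0 <= dot m (gen T' k (b' k))) ->
    forall k, inner k -> 0 <= dot m (gen T k (b k) *m A)) ->
  forall i j, 0 <= (basis_mx T b *m A *m invmx (basis_mx T' b')) i j.
Proof.
move=> hT' h i j; have u' := basis_unit n_gt0 hT' b'.
set m : 'rV[int]_n := (col j (invmx (basis_mx T' b')))^T.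
have mE (X : 'M[int]_n) k : dot m (row k X) = (X *m invmx (basis_mx T' b')) k j.
  by rewrite [RHS]mxE; apply: eq_bigr => l _; rewrite mxE [row k X 0 l]mxE [col _ _ _ _]mxE mulrC.
rewrite -mE row_mul row_basis_mx; apply: h (inner_inner_vtx i) => k /inner_vtxP[l ->].
by rewrite -row_basis_mx mE mulmxV // mxE ler0n.
Qed.

(** In the chosen bases [A] and [B] become nonnegative matrices [N] and [N']. Once the composite is
    seen to return to the initial cone, they are mutually inverse, hence monomial, and primitivity
    makes the entries 1. *)
Lemma cone_to_cone_gen (T T' : {set edge n}) A B :
  is_triangulation T -> is_triangulation T' -> A *m B = 1%:M ->
  cone_to_cone T T' A -> cone_to_cone T' T B ->
  forall b, exists b', forall k, inner k ->
    exists2 j, inner j & gen T k (b k) *m A = gen T' j (b' j).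
Proof.
move=> hT hT' AB hA hB b; have [b' h1] := hA b; have [b2 h2] := hB b'.
have BA : B *m A = 1%:M by apply: mulmx1C.
exists b'; set X := basis_mx T b; set X' := basis_mx T' b'; set X2 := basis_mx T b2.
have uX := basis_unit n_gt0 hT b; have uX' := basis_unit n_gt0 hT' b'.
have uX2 := basis_unit n_gt0 hT b2; rewrite -/X -/X' -/X2 in uX uX' uX2.
have N0 := cone_to_cone_coord hT' h1; have N'0 := cone_to_cone_coord hT h2.
rewrite -/X -/X' -/X2 in N0 N'0.
set N := X *m A *m invmx X' in N0; set N' := X' *m B *m invmx X2 in N'0.
have NX : N *m X' = X *m A by rewrite mulmxKV.
have N'X : N' *m X2 = X' *m B by rewrite mulmxKV.
have NN'X : N *m N' *m X2 = X by rewrite -mulmxA N'X mulmxA NX -mulmxA AB mulmx1.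
clearbody N N'.
(* A generator in [X] but not in [X2] would be separated from the cone of [X2], although [N *m N']
   expresses it there with nonnegative coefficients. *)
have X2X : X2 = X.
  apply/row_matrixP => i; rewrite !row_basis_mx.
  have ii := inner_inner_vtx i; set k := inner_vtx i in ii *.
  suff : gen T k (b k) \in basis T b2 by rewrite mem_basis_gen // => /eqP ->.
  apply: contraT => nin.
  have [m [_ m2 m3]] := separation n_gt0 hT (valid1 n_gt0 (b k) hT ii) (basis_valid n_gt0 hT b2).
  have := m3 (gen T k (b k)); rewrite inE eqxx nin => /(_ isT isT).
  rewrite ltNge => /negP; case; rewrite -row_basis_mx -/X -NN'X row_mul mulmx_sum_row dot_sumr.
  apply: sumr_le0 => j _; rewrite dotZr mulr_ge0_le0 //; last first.
    apply: m2; rewrite row_basis_mx; apply/mem_basis.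
    by exists (inner_vtx j); rewrite ?inner_inner_vtx.
  by rewrite !mxE; apply: sumr_ge0 => l _; rewrite mulr_ge0.
have NN' : N *m N' = 1%:M.
  by rewrite -(mulmxK uX2 (N *m N')) NN'X X2X mulmxV.
move=> k /inner_vtxP[i ->].
have [j Nij] : exists j, N i j != 0.
  apply: contrapT => hno; have := congr1 (fun M : 'M_n => M i i) NN'.
  rewrite !mxE eqxx big1 => [/eqP|j _]; first by rewrite eq_sym oner_eq0.
  suff -> : N i j = 0 by rewrite mul0r.
  by apply/eqP; apply: contraT => ne; case: hno; exists j.
(* An off-diagonal entry of [N *m N'] is a vanishing sum of nonnegative terms, so each term is 0. *)
have N'ji l : l != i -> N' j l = 0.
  move=> li; have := congr1 (fun M : 'M_n => M i l) NN'.
  rewrite !mxE eq_sym (negPf li) => /eqP; rewrite psumr_eq0 => [|a _]; last exact: mulr_ge0.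
  by move/allP/(_ j (mem_index_enum _)); rewrite /= mulf_eq0 (negPf Nij) => /eqP.
have genj : gen T' (inner_vtx j) (b' (inner_vtx j)) =
    N' j i *: (gen T (inner_vtx i) (b (inner_vtx i)) *m A).
  rewrite -!row_basis_mx -/X -/X' scalemxAl -[in LHS](mulmx1 X') -BA mulmxA -N'X X2X.
  rewrite row_mul; congr (_ *m _); rewrite row_mul mulmx_sum_row (bigD1 i) //= big1 ?addr0.
    by rewrite mxE.
  by move=> l li; rewrite mxE N'ji // scale0r.
exists (inner_vtx j); first exact: inner_inner_vtx.
rewrite genj; suff -> : N' j i = 1 by rewrite scale1r.
have [l hl] := gen_neq0 n_gt0 hT' (b' (inner_vtx j)) (inner_inner_vtx j).
move: hl; rewrite genj mxE normrM ger0_norm //.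
move: (N' j i) (N'0 j i) (_ 0 l) => c c0 x hx.
case: c c0 hx => // c _; rewrite -abszE -PoszM => -[/eqP].
by rewrite muln_eq1 => /andP[/eqP ->].
Qed.

Lemma cone_to_cone_sib (T T' : {set edge n}) A B :
  is_triangulation T -> is_triangulation T' -> A *m B = 1%:M ->
  cone_to_cone T T' A -> cone_to_cone T' T B ->
  forall q1 q2, sibling T q1 q2 -> sibling T' (q1 *m A) (q2 *m A).
Proof.
move=> hT hT' AB hA hB _ _ [k [b [ik -> ->]]].
have BA : B *m A = 1%:M by apply: mulmx1C.
have gA c : exists k' c', inner k' /\ gen T k c *m A = gen T' k' c'.
  have [b' h] := cone_to_cone_gen hT hT' AB hA hB (fun=> c).
  by have [j ij e] := h k ik; exists j, (b' j).
have [j [c [ij e]]] := gA b; have [j' [c' [ij' e']]] := gA (~~ b).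
have eB : gen T' j c *m B = gen T k b by rewrite -e -mulmxA AB mulmx1.
have eB' : gen T' j' c' *m B = gen T k (~~ b) by rewrite -e' -mulmxA AB mulmx1.
case: (eqVneq j j') => [ejj|ne].
  exists j, c; split=> //; rewrite e' -ejj; congr gen.
  case: (eqVneq c' c) => [ecc|]; last by case: c c' {e e' eB eB'} => [] [].
  have : gen T k b = gen T k (~~ b) by rewrite -eB -eB' ejj ecc.
  by move=> /(gen_inj n_gt0 hT ik ik)[_]; case: b {e e' eB eB'}.
(* If the images belonged to different pairs, one maximal cone would contain both; [B] would then
   put [gen T k b] and its sibling into a single maximal cone, which picks only one of them. *)
have [b' h] := cone_to_cone_gen hT' hT BA hB hA (fun l => if l == j then c else c').
have [i ii] := h j ij; rewrite eqxx eB => /(gen_inj n_gt0 hT ik ii)[<- e1].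
have [i' ii'] := h j' ij'; rewrite eq_sym (negPf ne) eB' => /(gen_inj n_gt0 hT ik ii')[<-].
by rewrite -e1; case: b {e e' eB eB' e1}.
Qed.

End ConeToCone.

Lemma toric_iso_sib_iso (R : realType) n (T T' : {set edge n}) : (0 < n)%N ->
  is_triangulation T -> is_triangulation T' ->
  toric_iso (triangulation_fan R T) (triangulation_fan R T') -> sib_iso T T'.
Proof.
move=> n0 hT hT' [f [g [hf hg gf fg]]].
have [A hA] := toric_morphism_mx n0 hT' hf.
have [B hB] := toric_morphism_mx n0 hT hg.
have AB := induces_comp n0 hT hg hA hB gf.
have BA := mulmx1C AB; have [uA uB] := mulmx1_unit AB.
have cA := induces_cone n0 hT hT' hf hA.
have cB := induces_cone n0 hT' hT hg hB.
exists A => // q1 q2; split; first exact: (cone_to_cone_sib n0 hT hT' AB cA cB).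
by move=> /(cone_to_cone_sib n0 hT' hT BA cB cA); rewrite -!mulmxA AB !mulmx1.
Qed.

Theorem theorem6p6 (R : realType) (n : nat) (T T' : {set edge n})
    (hn : (1 <= n)%N) (hT : is_triangulation T) (hT' : is_triangulation T') :
  (fan_iso (triangulation_fan R T) (triangulation_fan R T') <->
     unordered_iso (binary_tree T) (binary_tree T')) /\
  (fan_iso (triangulation_fan R T) (triangulation_fan R T') <->
     toric_iso (triangulation_fan R T) (triangulation_fan R T')).
Proof.
split; split.
- by move/(fan_iso_sib_iso hn hT hT')/(sib_iso_unordered_iso hn hT hT').
- by move/(unordered_iso_sib_iso hn hT hT')/sib_iso_fan_iso; apply.
- exact: fan_iso_toric_iso.
- by move/(toric_iso_sib_iso hn hT hT')/sib_iso_fan_iso; apply.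
Qed.
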